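(* Assume that the Nicholson system $$y_i'(t)=-\tilde d_i(t)\,y_i(t)+\sum_{j=1}^m \tilde a_{ij}(t)\,y_j(t)+\tilde\beta_i(t)\,y_i(t-r_i)\,e^{-\tilde c_i(t)\,y_i(t-r_i)},\quad t\ge 0,\quad i=1,\ldots,m,$$ with delays $r_i>0$, satisfies assumptions (a1)--(a6) listed in the context. Then there is a global attractor $\mathbb{A}\subset\Omega\times X_+$, with respect to the class $\mathcal{D}_b(X_+)$ of bounded subsets of $X_+$, for the induced skew-product semiflow $\tau:\mathbb{R}_+\times\Omega\times X_+\to\Omega\times X_+$, $(t,\omega,\varphi)\mapsto(\omega\cdot t,y_t(\omega,\varphi))$. That is, there is a compact set $\mathbb{A}\subset\Omega\times X_+$ such that $\tau_t(\mathbb{A})=\mathbb{A}$ for all $t\ge 0$ and $\lim_{t\to\infty}\mathrm{dist}(\tau_t(\Omega\times X_1),\mathbb{A})=0$ for every bounded $X_1\subset X_+$.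
   Context: Almost periodicity: a continuous function $h:\mathbb{R}\to\mathbb{R}$ is almost periodic if for every $\varepsilon>0$ the set $\{s\in\mathbb{R}: |h(t+s)-h(t)|<\varepsilon \text{ for all } t\in\mathbb{R}\}$ is relatively dense in $\mathbb{R}$. Assumptions on the coefficients: (a1) $\tilde d_i,\tilde a_{ij},\tilde c_i,\tilde\beta_i$ are almost periodic functions on $\mathbb{R}$; (a2) there is a constant $d_0>0$ with $\tilde d_i(t)\ge d_0$ for each $t\in\mathbb{R}$ and $i\in\{1,\dots,m\}$; (a3) all $\tilde a_{ij}(t)$ are nonnegative functions and $\tilde a_{ii}$ is identically null; (a4) $\tilde\beta_i(t)>0$ for each $t\in\mathbb{R}$ and $i$; (a5) there is a constant $c_0>0$ with $\tilde c_i(t)\ge c_0$ for each $t\in\mathbb{R}$ and $i$; (a6) $\tilde d_i(t)-\sum_{j=1}^m\tilde a_{ji}(t)>0$ for each $t\in\mathbb{R}$ and $i$. State space: $X=C([-r_1,0])\times\cdots\times C([-r_m,0])$ (real-valued continuous functions) with the supremum norm, and $X_+=\{\phi\in X:\phi_i(s)\ge0 \text{ for } s\in[-r_i,0],\ 1\le i\le m\}$. For a continuous $y:[-r,\infty)\to\mathbb{R}^m$, $r=\max(r_1,\dots,r_m)$, and $t\ge0$, $y_t\in X$ is defined by $(y_t)_i(s)=y_i(t+s)$, $s\in[-r_i,0]$. Hull: let $l:\mathbb{R}\to\mathbb{R}^N$ be the map collecting all the coefficients, $l(t)=(\tilde d_i(t),\tilde a_{ij}(t),\tilde\beta_i(t),\tilde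 c_i(t))$, and let $\Omega$ be its hull, i.e. the closure of the set of time-translates of $l$ in the compact-open topology. $\Omega$ is a compact metric space and $(\omega\cdot t)(s)=\omega(t+s)$ defines a continuous flow on $\Omega$. Define continuous nonnegative maps $d_i,a_{ij},\beta_i,c_i:\Omega\to\mathbb{R}$ by $(d_i(\omega),a_{ij}(\omega),\beta_i(\omega),c_i(\omega))=\omega(0)$. For $\omega\in\Omega$ and $\varphi\in X$, $y(t,\omega,\varphi)$ denotes the solution of $$y_i'(t)=-d_i(\omega\cdot t)\,y_i(t)+\sum_{j=1}^m a_{ij}(\omega\cdot t)\,y_j(t)+\beta_i(\omega\cdot t)\,y_i(t-r_i)\,e^{-c_i(\omega\cdot t)\,y_i(t-r_i)},\quad i=1,\dots,m,$$ with initial value $\varphi$ (i.e. $y_0=\varphi$), and $y_t(\omega,\varphi)\in X$ is the corresponding segment at time $t$. For $\varphi\in X_+$ solutions are defined for all $t\ge0$ and $y_t(\omega,\varphi)\in X_+$, so $\tau$ is a continuous semiflow on $\Omega\times X_+$; $\tau_t(\omega,\varphi)=\tau(t,\omega,\varphi)$. Here $\mathrm{dist}$ is the Hausdorff semidistance, $\mathrm{dist}(B,A)=\sup_{b\in B}\inf_{a\in A}d(b,a)$, for a product metric on $\Omega\times X$. *)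

(* Defs.v *)
From HB Require Import structures.
From mathcomp Require Import all_boot all_order all_algebra.
From mathcomp Require Import all_classical all_reals all_analysis.
From mathcomp Require Import lra.
Import Order.TTheory GRing.Theory Num.Theory.
Import numFieldNormedType.Exports.

Set Implicit Arguments.
Unset Strict Implicit.
Unset Printing Implicit Defensive.

Local Open Scope classical_set_scope.
Local Open Scope ring_scope.

Section sup_dist.
Context {R : realType} {K M : Type} (d : K -> M -> M -> R).

Definition sup_dist (x y : M) : R := sup (range (fun k => d k x y)).

Hypothesis d_ge0 : forall k x y, 0 <= d k x y.
Hypothesis d_bnd : forall x y, exists B, forall k, d k x y <= B.

Lemma sup_dist_ub k x y : d k x y <= sup_dist x y.
Proof.
apply: ub_le_sup; last by exists k.
by have [B hB] := d_bnd x y; exists B => _ [j _ <-].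
Qed.

Lemma sup_dist_le x y B : 0 <= B -> (forall k, d k x y <= B) ->
  sup_dist x y <= B.
Proof.
move=> B0 hB; rewrite /sup_dist.
have [->|/set0P ne] := eqVneq (range (fun k => d k x y)) set0.
  by rewrite sup0.
by apply: ge_sup => // _ [k _ <-].
Qed.

Lemma sup_dist_ge0 x y : 0 <= sup_dist x y.
Proof.
rewrite /sup_dist.
have [->|/set0P[_ [k _ _]]] := eqVneq (range (fun k => d k x y)) set0.
  by rewrite sup0.
exact: le_trans (d_ge0 k x y) (sup_dist_ub k x y).
Qed.

Lemma sup_distxx : (forall k x, d k x x = 0) -> forall x, sup_dist x x = 0.
Proof.
move=> h x; apply/eqP; rewrite eq_le sup_dist_ge0 andbT.
by apply: sup_dist_le => // k; rewrite h.
Qed.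

Lemma sup_dist_positivity :
  (forall x y, (forall k, d k x y = 0) -> x = y) ->
  forall x y, sup_dist x y = 0 -> x = y.
Proof.
move=> h x y h0; apply: h => k; apply/eqP; rewrite eq_le d_ge0 andbT.
by rewrite -h0; exact: sup_dist_ub.
Qed.

Lemma sup_dist_sym : (forall k x y, d k x y = d k y x) ->
  forall x y, sup_dist x y = sup_dist y x.
Proof.
by move=> h x y; rewrite /sup_dist; under eq_fun do rewrite h.
Qed.

Lemma sup_dist_triangle :
  (forall k y x z, d k x z <= d k x y + d k y z) ->
  forall y x z, sup_dist x z <= sup_dist x y + sup_dist y z.
Proof.
move=> h y x z; apply: sup_dist_le => [|k].
  by rewrite addr_ge0// sup_dist_ge0.
by rewrite (le_trans (h k y x z))// lerD// sup_dist_ub.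
Qed.

End sup_dist.

Lemma min_triangle {R : realFieldType} (p x y z : R) :
  0 <= p -> 0 <= y -> 0 <= z -> x <= y + z ->
  Num.min p x <= Num.min p y + Num.min p z.
Proof.
move=> p0 y0 z0 xyz; rewrite /Num.min.
by case: ifPn; case: ifPn; case: ifPn; rewrite -?leNgt => *; lra.
Qed.

Lemma within_itvcc_bounded {R : realType} (V : normedModType R) (a b : R)
    (f : R -> V) : {within `[a, b], continuous f} ->
  exists B, forall t, t \in `[a, b] -> `|f t| <= B.
Proof.
move=> cf.
have := compact_bounded (continuous_compact cf (@segment_compact _ a b)).
move=> [M [_ hM]]; exists (M + 1) => t tab.
by apply: (hM (M + 1)); [rewrite ltrDl | exists t].
Qed.

Lemma itvcc_fun_bounded {R : realType} (V : normedModType R) (a b : R)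
    (f : continuousType (set_type `[a, b]%classic) V) :
  exists B, forall s, `|f s| <= B.
Proof.
have cf : {within `[a, b], continuous (valL f)}.
  by apply/subspace_valL_continuousP; exact: cts_fun.
have [B hB] := within_itvcc_bounded cf; exists B => s.
have -> : f s = valL f (set_val s).
  by rewrite -[in LHS](valLK point f).
by apply: hB; have := set_valP s.
Qed.


(* The value space R^N, N = m + m ^ 2 + m + m, of
   t |-> (d_i(t), a_ij(t), beta_i(t), c_i(t)). *)
Definition coef_space (R : realType) (m : nat) : Type :=
  ('rV[R]_m * 'M[R]_m * 'rV[R]_m * 'rV[R]_m)%type.
HB.instance Definition _ (R : realType) (m : nat) :=
  NormedModule.copy (coef_space R m)
    ('rV[R]_m * 'M[R]_m * 'rV[R]_m * 'rV[R]_m)%type.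

Definition coef_fun (R : realType) (m : nat) : Type :=
  continuousType R (coef_space R m).
HB.instance Definition _ (R : realType) (m : nat) :=
  Choice.on (coef_fun R m).

Section coef_metric.
Context {R : realType} {m : nat}.
Implicit Types f g h : coef_fun R m.

Definition unif_dist (n : nat) : coef_fun R m -> coef_fun R m -> R :=
  sup_dist (fun (t : set_type `[- n%:R, n%:R : R]%classic) f g =>
    `|f (set_val t) - g (set_val t)|).

(* sup_n min(2^-n, max_(|t| <= n) |f(t) - g(t)|): a metric for the
   compact-open topology, see coef_cvgE below. *)
Definition coef_dist : coef_fun R m -> coef_fun R m -> R :=
  sup_dist (fun n f g => Num.min (2^-1 ^+ n) (unif_dist n f g)).

Let unif_bnd n f g : exists B,
  forall t : set_type `[- n%:R, n%:R : R]%classic,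
    `|f (set_val t) - g (set_val t)| <= B.
Proof.
have cfg : {within `[- n%:R, n%:R : R], continuous (fun t => f t - g t)}.
  by apply: continuous_subspaceT => t; apply: cvgB; exact: cts_fun.
have [B hB] := within_itvcc_bounded cfg; exists B => t.
by apply: hB; have := set_valP t.
Qed.

Lemma unif_dist_ub n f g t : - n%:R <= t <= n%:R ->
  `|f t - g t| <= unif_dist n f g.
Proof.
move=> tn; have tn' : t \in (`[- n%:R, n%:R : R]%classic : set R).
  by rewrite inE /= in_itv.
exact: (sup_dist_ub (@unif_bnd n) (exist _ t tn')).
Qed.

Lemma unif_dist_le n f g B : 0 <= B ->
  (forall t, - n%:R <= t <= n%:R -> `|f t - g t| <= B) ->
  unif_dist n f g <= B.
Proof.
move=> B0 h; apply: sup_dist_le => // t; apply: h.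
by have := set_valP t; rewrite /= in_itv.
Qed.

Lemma unif_dist_ge0 n f g : 0 <= unif_dist n f g.
Proof. exact: sup_dist_ge0 (@unif_bnd n) _ _. Qed.

Let pow_gt0 n : 0 < 2^-1 ^+ n :> R.
Proof. by rewrite exprn_gt0// invr_gt0. Qed.

Let min_ge0 n f g : 0 <= Num.min (2^-1 ^+ n) (unif_dist n f g).
Proof. by rewrite le_min ltW//= unif_dist_ge0. Qed.

Let min_bnd f g : exists B,
  forall n, Num.min (2^-1 ^+ n) (unif_dist n f g) <= B.
Proof.
exists 1 => n; rewrite ge_min exprn_ile1 ?invr_ge0//.
by rewrite invf_le1// ler1n.
Qed.

Let coef_distxx f : coef_dist f f = 0.
Proof.
apply: sup_distxx => // n g; apply/eqP; rewrite eq_le min_ge0 andbT ge_min.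
by apply/orP; right; apply: unif_dist_le => // t _; rewrite subrr normr0.
Qed.

Let coef_dist_positivity f g : coef_dist f g = 0 -> f = g.
Proof.
apply: sup_dist_positivity => // {}f {}g h; apply/continuousEP => t.
have [n tn] : exists n : nat, `|t| <= n%:R.
  by exists (Num.bound `|t|); rewrite ltW// archi_boundP.
have u0 : unif_dist n f g = 0.
  have := h n; rewrite /Num.min; case: ifPn => // _ /eqP.
  by rewrite gt_eqF.
apply/eqP; rewrite -subr_eq0 -normr_le0 -u0 unif_dist_ub//.
by rewrite -ler_norml.
Qed.

Let coef_dist_sym f g : coef_dist f g = coef_dist g f.
Proof.
apply: sup_dist_sym => n {}f {}g; congr (Num.min _ _).
by apply: sup_dist_sym => t {}f {}g; rewrite distrC.
Qed.

Let coef_dist_triangle g f h :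
  coef_dist f h <= coef_dist f g + coef_dist g h.
Proof.
apply: sup_dist_triangle => // n {}g {}f {}h.
have tri : unif_dist n f h <= unif_dist n f g + unif_dist n g h.
  apply: sup_dist_triangle; [by []|exact: unif_bnd|].
  by move=> t {}g {}f {}h; exact: ler_distD.
exact: (min_triangle (ltW (pow_gt0 n)) (unif_dist_ge0 _ _ _)
  (unif_dist_ge0 _ _ _) tri).
Qed.

HB.instance Definition _ := @isMetric.Build R (coef_fun R m) coef_dist
  coef_distxx coef_dist_positivity coef_dist_sym coef_dist_triangle.

Lemma coef_cvgE (F : set_system (coef_fun R m)) (w : coef_fun R m) :
  Filter F ->
  F --> w <->
  {compact-open, (fun f : coef_fun R m => f : R -> coef_space R m) @ F -->
                 (w : R -> coef_space R m)}.
Proof.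
move=> FF; rewrite compact_open_fam_compactP; last exact: cts_fun.
rewrite fam_cvgP metricType_numDomainType.fcvgrPdist_lt; split=> h.
  move=> K cK P /uniform_nbhs[E [entE EP]].
  move: entE; rewrite -entourage_ballE => -[e /= e0 eE].
  have [M [_ hM]] := compact_bounded cK.
  have [n Kn] : exists n : nat, forall t, K t -> `|t| <= n%:R.
    exists (Num.bound (`|M| + 1)) => t Kt; apply: (@le_trans _ _ (`|M| + 1)).
      by apply: hM => //; rewrite ltr_pwDr// ler_norm.
    by rewrite ltW// archi_boundP// addr_ge0.
  have := h (Num.min (2^-1 ^+ n) e); rewrite lt_min pow_gt0 e0 => /(_ isT).
  apply: filterS => f wf; apply: EP => t Kt; apply: eE => /=.
  rewrite -ball_normE/=.
  have : Num.min (2^-1 ^+ n) (unif_dist n w f) < Num.min (2^-1 ^+ n) e.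
    exact: le_lt_trans (sup_dist_ub min_bnd n w f) wf.
  rewrite gt_min !lt_min ltxx/= => /andP[_ we].
  by apply: le_lt_trans we; apply: unif_dist_ub; rewrite -ler_norml Kn.
move=> e e0; have e20 : 0 < e / 2 by rewrite divr_gt0.
have [N hN] : exists N, forall n, (N <= n)%N -> 2^-1 ^+ n <= e / 2.
  have [N _ hN] : \forall n \near \oo, 2^-1 ^+ n <= e / 2 :> R.
    have : (2^-1 : R) ^+ n @[n --> \oo] --> 0.
      by apply: cvg_expr; rewrite ger0_norm ?invr_ge0// invf_lt1// ltr1n.
    move/cvgrPdist_le => /(_ _ e20); apply: filterS => n.
    by rewrite sub0r normrN ger0_norm// ltW.
  by exists N => n; exact: hN.
pose I := `[- N%:R, N%:R : R]%classic.
pose P : set {uniform` I -> coef_space R m} :=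
  [set f | forall t, I t -> ball (w t) (e / 2) (f t)].
have nP : nbhs ((w : R -> coef_space R m) : {uniform` I -> coef_space R m}) P.
  apply/uniform_nbhs; exists [set xy | ball xy.1 (e / 2) xy.2]; split => //.
  by rewrite -entourage_ballE; exists (e / 2).
have FP : F [set f : coef_fun R m | P f] := h _ (@segment_compact _ _ _) _ nP.
apply: (filterS _ FP) => f wf.
have uN : unif_dist N w f <= e / 2.
  apply: unif_dist_le => [|t tN]; first exact: ltW.
  have /wf : I t by rewrite /I /= in_itv.
  by rewrite -ball_normE/= => /ltW.
apply: (@le_lt_trans _ _ (e / 2)); last by rewrite ltr_pdivrMr// ltr_pMr// ltr1n.
apply: sup_dist_le => [|n]; first exact: ltW.
rewrite ge_min; have [nN|Nn] := leqP N n; first by rewrite hN.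
apply/orP; right; apply: le_trans uN; apply: unif_dist_le => [|t tn].
  exact: unif_dist_ge0.
apply: unif_dist_ub; move: tn; rewrite -!ler_norml => /le_trans; apply.
by rewrite ler_nat ltnW.
Qed.

End coef_metric.

(* C([-r_1, 0]) x ... x C([-r_m, 0]) *)
Definition history (R : realType) (m : nat) (r : 'I_m -> R) : Type :=
  forall i : 'I_m, continuousType (set_type `[- r i, 0]%classic) R.
HB.instance Definition _ (R : realType) (m : nat) (r : 'I_m -> R) :=
  gen_eqMixin (history r).
HB.instance Definition _ (R : realType) (m : nat) (r : 'I_m -> R) :=
  gen_choiceMixin (history r).

Section history_metric.
Context {R : realType} {m : nat} {r : 'I_m -> R}.
Implicit Types phi psi : history r.

Definition history_dist : history r -> history r -> R :=
  sup_dist (fun (p : {i : 'I_m & set_type `[- r i, 0]%classic}) phi psi =>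
    `|phi (tag p) (tagged p) - psi (tag p) (tagged p)|).

Let bnd1 phi : exists B,
  forall i (s : set_type `[- r i, 0]%classic), `|phi i s| <= B.
Proof.
have /choice[B hB] : forall i, exists B, forall s, `|phi i s| <= B.
  by move=> i; exact: itvcc_fun_bounded.
exists (\sum_i `|B i|) => i s; rewrite (le_trans (hB i s))//.
by rewrite (bigD1 i)//= (le_trans (ler_norm _))// lerDl sumr_ge0.
Qed.

Let bnd phi psi : exists B,
  forall p : {i : 'I_m & set_type `[- r i, 0]%classic},
  `|phi (tag p) (tagged p) - psi (tag p) (tagged p)| <= B.
Proof.
have [[B hB] [C hC]] := (bnd1 phi, bnd1 psi); exists (B + C) => p.
by rewrite (le_trans (ler_normB _ _))// lerD.
Qed.

Let history_distxx phi : history_dist phi phi = 0.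
Proof. by apply: sup_distxx => // p psi; rewrite subrr normr0. Qed.

Let history_dist_positivity phi psi : history_dist phi psi = 0 -> phi = psi.
Proof.
apply: sup_dist_positivity => // {}phi {}psi h.
apply: functional_extensionality_dep => i; apply/continuousEP => s.
by have /eqP := h (existT _ i s); rewrite normr_eq0 subr_eq0 => /eqP.
Qed.

Let history_dist_sym phi psi : history_dist phi psi = history_dist psi phi.
Proof. by apply: sup_dist_sym => p {}phi {}psi; rewrite distrC. Qed.

Let history_dist_triangle psi phi chi :
  history_dist phi chi <= history_dist phi psi + history_dist psi chi.
Proof.
by apply: sup_dist_triangle => // p {}psi {}phi {}chi; exact: ler_distD.
Qed.

HB.instance Definition _ := @isMetric.Build R (history r) history_dist
  history_distxx history_dist_positivity history_dist_sym
  history_dist_triangle.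

End history_metric.

Definition relatively_dense {R : realType} (S : set R) : Prop :=
  exists2 L, 0 < L & forall a, exists2 s, S s & a <= s <= a + L.

Definition almost_periodic {R : realType} (h : R -> R) : Prop :=
  continuous h /\
  forall e, 0 < e -> relatively_dense [set s | forall t, `|h (t + s) - h t| < e].

Section nicholson.
Context {R : realType} {m : nat}.

Definition coefficient_map (d : 'I_m -> R -> R) (a : 'I_m -> 'I_m -> R -> R)
    (beta c : 'I_m -> R -> R) (t : R) : coef_space R m :=
  (\row_i d i t, \matrix_(i, j) a i j t, \row_i beta i t, \row_i c i t).

(* The closure is for the metric of coef_fun R m, which induces the
   compact-open topology. *)
Definition hull (l : R -> coef_space R m) : set (coef_fun R m) :=
  closure [set w : coef_fun R m | exists s, forall t, w t = l (t + s)].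

Lemma translate_continuous (t : R) (w : coef_fun R m) :
  continuous (fun s => w (t + s)).
Proof.
move=> s; apply: (@continuous_comp _ _ _ (+%R t) w); last exact: cts_fun.
by apply: cvgD; [exact: cvg_cst|exact: cvg_id].
Qed.

Definition flow (t : R) (w : coef_fun R m) : coef_fun R m :=
  mkcts (@translate_continuous t w).

Definition coef_d (w : coef_fun R m) (i : 'I_m) : R := (w 0).1.1.1 0 i.
Definition coef_a (w : coef_fun R m) (i j : 'I_m) : R := (w 0).1.1.2 i j.
Definition coef_beta (w : coef_fun R m) (i : 'I_m) : R := (w 0).1.2 0 i.
Definition coef_c (w : coef_fun R m) (i : 'I_m) : R := (w 0).2 0 i.

Variable r : 'I_m -> R.

Definition nicholson_rhs (w : coef_fun R m) (y : 'I_m -> R -> R)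
    (i : 'I_m) (t : R) : R :=
  - coef_d (flow t w) i * y i t
  + \sum_j coef_a (flow t w) i j * y j t
  + coef_beta (flow t w) i * y i (t - r i)
    * expR (- coef_c (flow t w) i * y i (t - r i)).

Definition is_segment (y : 'I_m -> R -> R) (t : R) (phi : history r) : Prop :=
  forall i (s : set_type `[- r i, 0]%classic), phi i s = y i (t + set_val s).

(* Only the values of y i on [- r i, +oo[ are relevant; at t = 0 the equation
   holds for the right derivative. *)
Definition is_solution (w : coef_fun R m) (phi : history r)
    (y : 'I_m -> R -> R) : Prop :=
  [/\ is_segment y 0 phi,
      forall i, {within `[- r i, +oo[, continuous (y i)},
      forall i (t : R), 0 < t -> is_derive t 1 (y i) (nicholson_rhs w y i t) &
      forall i, h^-1 * (y i h - y i 0) @[h --> 0^'+] -->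
                nicholson_rhs w y i 0].

(* xget selects y_t(w, phi), which exists and is unique for phi in
   nonneg_cone and t >= 0; the default value phi is never used there. *)
Definition skew_product (t : R) (p : coef_fun R m * history r) :
    coef_fun R m * history r :=
  (flow t p.1,
   xget p.2 [set psi | exists2 y, is_solution p.1 p.2 y & is_segment y t psi]).

Definition nonneg_cone : set (history r) :=
  [set phi | forall i s, 0 <= phi i s].

Definition bounded_histories (X1 : set (history r)) : Prop :=
  exists B, forall phi, X1 phi -> forall i s, `|phi i s| <= B.

End nicholson.

Arguments nonneg_cone {R m} r.

Section hausdorff_semidistance.
Context {R : realType} {S T : metricType R}.

Definition prod_dist (p q : S * T) : R :=
  Num.max (mdist p.1 q.1) (mdist p.2 q.2).

(* The supremum is taken in [0, +oo], so the semidistance from set0 is 0;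
   that of a nonempty B to set0 is +oo. *)
Definition hausdorff_semidist (B A : set (S * T)) : \bar R :=
  ereal_sup (0%E |`
    [set ereal_inf [set (prod_dist b a)%:E | a in A] | b in B]).

End hausdorff_semidistance.

(* Main.v *)
Require Import Defs.
From mathcomp Require Import all_boot all_order all_algebra.
From mathcomp Require Import all_classical all_reals all_analysis.
From mathcomp Require Import ring lra.
Import Order.TTheory GRing.Theory Num.Theory.
Import numFieldNormedType.Exports.

Set Implicit Arguments.
Unset Strict Implicit.
Unset Printing Implicit Defensive.

Local Open Scope classical_set_scope.
Local Open Scope ring_scope.

(* The attractor is the set A of all (w, y_0), w in the hull, for which y is an
   entire solution with 0 <= y <= M. Its invariance is immediate from unique
   solvability, and both compactness and attraction follow from one fact: along
   an ultrafilter, bounded solutions on half-lines [- T, +oo[ with T --> +oo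
   converge to an entire solution. Neither continuity of the semiflow nor
   omega-limit sets are needed.
   The bound M comes from the total mass V = sum_i y_i: the nonlinearity is
   bounded, so by a6 V' <= - delta(t) V + C with delta(t) the least of the rates
   d_i - sum_j a_ji. They are positive but not bounded away from 0; however, by
   joint almost periodicity they stay above a fixed eta > 0 on a subinterval of
   fixed length of every sufficiently long interval, uniformly on the hull. *)

(** * Calculus *)

Section calculus.
Context {R : realType}.
Implicit Types (f g : R -> R) (a b c x y : R).

(** The total mass is the right functional because a6 controls column sums: adding the equations and
    exchanging the double sum leaves - (d_i - sum_j a_ji) as the coefficient of y_i. The obstacle is
    that an almost periodic function can be positive with infimum 0, and then vanishes somewhere on
    the hull. Outside the good subintervals V is therefore only known to grow at speed at most C.
    Over a window of length P this still gives V(t + P) <= q V(t) + C' with q = e^(- eta len) and C'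
    = 2 C P + C / eta; M is 1 plus the fixed point C' / (1 - q). The size of the initial data
    affects only the waiting time, not M. Attraction is by contradiction: orbits that stay away at
    times t_n >= n are translated by t_n, which sends their starting time to - oo, while the bound
    M, valid after a common waiting time, holds on half-lines that exhaust the real line. Bounds on
    y' depend on K, m and M only, so limits are locally uniform and the equation passes to them. *)

Lemma derivative_ge0_le f f' a b : a <= b ->
  {within `[a, b], continuous f} ->
  (forall x, a < x < b -> is_derive x 1 f (f' x)) ->
  (forall x, a < x < b -> 0 <= f' x) -> f a <= f b.
Proof.
rewrite le_eqVlt => /predU1P[->//|ab] cf df f'0.
have dfab x : x \in `]a, b[ -> is_derive x 1 f (f' x).
  by rewrite in_itv/=; exact: df.
have [x xab] := MVT ab dfab cf.
move/(congr1 (fun z => z + f a)); rewrite subrK => ->.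
by rewrite lerDr mulr_ge0 ?subr_ge0 ?(ltW ab)// f'0//; rewrite in_itv/= in xab.
Qed.

Lemma increment_le f f' g g' a b : a <= b ->
  {within `[a, b], continuous f} -> {within `[a, b], continuous g} ->
  (forall x, a < x < b -> is_derive x 1 f (f' x)) ->
  (forall x, a < x < b -> is_derive x 1 g (g' x)) ->
  (forall x, a < x < b -> f' x <= g' x) -> f b - f a <= g b - g a.
Proof.
move=> ab cf cg df dg fg.
have : (g - f) a <= (g - f) b.
  apply: (@derivative_ge0_le _ (fun x => g' x - f' x)) => //.
  - by move=> x; apply: cvgB; [exact: cg|exact: cf].
  - by move=> x xab; have := df x xab; have := dg x xab => *; exact: is_deriveB.
  - by move=> x xab; rewrite subr_ge0 fg.
by rewrite !fctE; lra.
Qed.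

Lemma normr_increment_le f f' g g' a b : a <= b ->
  {within `[a, b], continuous f} -> {within `[a, b], continuous g} ->
  (forall x, a < x < b -> is_derive x 1 f (f' x)) ->
  (forall x, a < x < b -> is_derive x 1 g (g' x)) ->
  (forall x, a < x < b -> `|f' x| <= g' x) -> `|f b - f a| <= g b - g a.
Proof.
move=> ab cf cg df dg fg; rewrite ler_norml; apply/andP; split; last first.
  apply: (increment_le ab cf cg df dg) => x xab.
  exact: le_trans (ler_norm _) (fg x xab).
rewrite lerNl; have -> : - (f b - f a) = (- f) b - (- f) a.
  by rewrite !fctE; lra.
apply: (@increment_le (- f) (fun x => - f' x) g g') => //.
- by move=> x; apply: cvgN; exact: cf.
- by move=> x xab; have := df x xab => ?; exact: is_deriveN.
- by move=> x xab; rewrite (le_trans _ (fg x xab))// -normrN ler_norm.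
Qed.

(** Integration starts at -1 so that 0 is an interior point: the derivative at 0 is two-sided, and
    the initial slope of a solution can be read off from it. *)
Lemma antiderivative f : continuous f -> exists F : R -> R,
  F 0 = 0 /\ forall t : R, -1 < t -> is_derive t 1 F (f t).
Proof.
move=> cf.
pose F x := (\int[lebesgue_measure]_(t in `[-1, x]) f t)%R.
exists (fun x => F x - F 0); split; first by rewrite subrr.
move=> t t1.
have fi : lebesgue_measure.-integrable `[-1, t + 1] (EFin \o f).
  apply: continuous_compact_integrable; first exact: segment_compact.
  exact: continuous_subspaceT.
have tt : t < t + 1 by rewrite ltrDl.
have [dF F'] := continuous_FTC1_closed tt fi t1 (cf t).
have dF' : is_derive t 1 F (f t).
  by split; [exact: dF|rewrite -F' derive1E].
have -> : f t = f t - 0 by rewrite subr0.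
exact: (@is_deriveB _ _ _ F (cst (F 0))).
Qed.

Lemma is_derive_mulrl a x : is_derive x 1 (fun t => a * t) a.
Proof.
have h := @is_deriveZ _ _ _ id a x 1 1 (is_derive_id _ _).
by apply: is_derive_eq h _; rewrite /= /GRing.scale/= mulr1.
Qed.

Lemma is_derive_expRM a x :
  is_derive x 1 (fun t => expR (a * t)) (a * expR (a * x)).
Proof.
rewrite mulrC.
exact: (is_derive1_comp (is_derive_expR _) (is_derive_mulrl a x)).
Qed.

Lemma continuous_expRM a : continuous (fun t : R => expR (a * t)).
Proof.
move=> t; apply: (@continuous_comp _ _ _ ( *%R a) expR).
  by apply: mulrl_continuous.
exact: continuous_expR.
Qed.

Lemma is_derive_continuous f (l x : R) :
  is_derive x 1 f l -> {for x, continuous f}.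
Proof.
by case=> h _; apply/differentiable_continuous/derivable1_diffP.
Qed.

Lemma is_derive_right_slope f (l x : R) : is_derive x 1 f l ->
  h^-1 * (f (x + h) - f x) @[h --> 0^'+] --> l.
Proof.
case=> df dfE.
have : h^-1 *: (f (h *: 1 + x) - f x) @[h --> 0^'+] --> 'D_1 f x.
  exact: cvg_dnbhs_at_right.
rewrite dfE; apply: cvg_trans; apply: near_eq_cvg; near=> h.
by rewrite /GRing.scale/= mulr1 (addrC h x).
Unshelve. all: by end_near. Qed.

(* The derivative (1 - u) e^-u of u |-> u e^-u is at most e^(2 C B) in absolute
   value for u >= - C B. *)
Lemma ricker_lipschitz (B C c x y : R) : 0 <= B -> 0 <= c <= C ->
  - B <= x -> - B <= y ->
  `|x * expR (- c * x) - y * expR (- c * y)| <= expR (2 * (C * B)) * `|x - y|.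
Proof.
move=> B0 /andP[c0 cC].
wlog xy : x y / y <= x.
  move=> H xB yB; have [yx|/ltW xy] := leP y x; first exact: H.
  by rewrite distrC (distrC x); apply: H.
move=> xB yB.
pose h (t : R) : R := t * expR (- c * t).
pose h' (t : R) : R := (1 - c * t) * expR (- c * t).
have dh (t : R) : is_derive t 1 h (h' t).
  have d1 := is_derive_expRM (- c) t.
  have := @is_deriveM _ _ id (fun t => expR (- c * t)) t 1 1 _
    (is_derive_id _ _) d1.
  move=> H; apply: is_derive_eq H _; rewrite /h' /GRing.scale/=; ring.
have ch : continuous h by move=> t; exact: is_derive_continuous (dh t).
have dg := is_derive_mulrl (expR (2 * (C * B))).
have xy0 : 0 <= x - y by rewrite subr_ge0.
rewrite (ger0_norm xy0) mulrBr.
apply: (@normr_increment_le h h' (fun t => expR (2 * (C * B)) * t)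
  (fun=> expR (2 * (C * B))) y x xy) => //.
- exact: continuous_subspaceT.
- by apply: continuous_subspaceT => t; exact: is_derive_continuous (dg t).
move=> t /andP[yt tx]; rewrite /h' normrM (ger0_norm (expR_ge0 _)) mulNr expRN.
rewrite ler_pdivrMr ?expR_gt0// -expRD.
have tB : - B <= t by lra.
have ctB : - (C * B) <= c * t.
  rewrite -mulrN (@le_trans _ _ (c * - B))//; last by rewrite ler_wpM2l.
  by rewrite !mulrN lerN2 ler_wpM2r.
have CB : 0 <= C * B by rewrite mulr_ge0// (le_trans c0).
(* Both cases use e^u >= 1 + u: for c t >= 0 it bounds 1 + c t directly; otherwise 1 - c t <= e^(- c
   t), and - c t <= C B gives - c t <= 2 C B + c t. *)
have [u0|u0] := leP 0 (c * t).
  have := expR_ge1Dx (2 * (C * B) + c * t).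
  by rewrite ler_norml; lra.
have e1 := expR_ge1Dx (- (c * t)).
rewrite ger0_norm; last by lra.
rewrite (le_trans e1)// ler_expR; lra.
Qed.

(** Since c0 x <= c x <= e^(c x). This is where a5 enters: it bounds the delayed production
    uniformly in the population. *)
Lemma ricker_bounds (c c0 x : R) : 0 < c0 -> c0 <= c -> 0 <= x ->
  0 <= x * expR (- c * x) <= c0^-1.
Proof.
move=> c00 c0c x0; rewrite mulr_ge0 ?expR_ge0//= mulNr expRN.
rewrite ler_pdivrMr ?expR_gt0// ler_pdivlMl//.
have := expR_ge1Dx (c * x).
have : c0 * x <= c * x by rewrite ler_wpM2r.
lra.
Qed.

(** The sequences u_k - 2 C 2^-k and u_k + 2 C 2^-k are monotone and enclose each other, so the
    supremum of the first is the limit, with an explicit error. *)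
Lemma geometric_cauchy_limit (u : nat -> R) (C : R) :
  (forall k, `|u k.+1 - u k| <= C * 2^-1 ^+ k) ->
  exists l, forall k, `|u k - l| <= 2 * C * 2^-1 ^+ k.
Proof.
move=> uC; have C0 : 0 <= C.
  by have := uC 0; rewrite expr0 mulr1; exact: le_trans.
pose v k := u k - 2 * C * 2^-1 ^+ k.
pose w k := u k + 2 * C * 2^-1 ^+ k.
have v_inc j k : (j <= k)%N -> v j <= v k.
  apply: (homo_leq (r := fun a b : R => a <= b)) => [//|? ? ?|i].
    exact: le_trans.
  have := uC i; rewrite /v exprS ler_norml; lra.
have w_dec j k : (j <= k)%N -> w k <= w j.
  apply: (homo_leq (r := fun a b : R => b <= a)) => [//|x y z yx zx|i].
    exact: le_trans zx yx.
  have := uC i; rewrite /w exprS ler_norml; lra.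
have vw j : v j <= w j.
  have : 0 <= C * 2^-1 ^+ j by rewrite mulr_ge0// exprn_ge0.
  by rewrite /v /w; lra.
have vw2 j k : v j <= w k.
  have [jk|/ltnW kj] := leqP j k.
    exact: le_trans (v_inc _ _ jk) (vw k).
  exact: le_trans (vw j) (w_dec _ _ kj).
exists (sup (range v)) => k.
have h1 : v k <= sup (range v).
  by apply: ub_le_sup; [exists (w 0) => _ [j _ <-]|exists k].
have h2 : sup (range v) <= w k.
  by apply: ge_sup; [exists (v 0); exists 0|move=> _ [j _ <-]].
by move: h1 h2; rewrite /v /w ler_norml; lra.
Qed.

Lemma geometric_eventually_le (q C e : R) : 0 <= q < 1 -> 0 < e ->
  exists N, forall n, (N <= n)%N -> C * q ^+ n <= e.
Proof.
move=> /andP[q0 q1] e0; have : q ^+ n @[n --> \oo] --> 0.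
  by apply: cvg_expr; rewrite ger0_norm.
have C1 : 0 < `|C| + 1 by rewrite ltr_pwDr.
move/cvgrPdist_le => /(_ _ (divr_gt0 e0 C1))[N _ hN].
exists N => n Nn; have := hN n Nn.
rewrite /= sub0r normrN ger0_norm ?exprn_ge0// ler_pdivlMr// => h.
rewrite (le_trans _ h)// mulrC ler_wpM2l ?exprn_ge0//.
by rewrite (le_trans (ler_norm _))// lerDl.
Qed.

Lemma halfpow_eventually_le (C e : R) : 0 < e -> exists k, C * 2^-1 ^+ k <= e.
Proof.
move=> e0; have h : 0 <= (2^-1 : R) < 1.
  by rewrite invr_ge0 ler0n/= invf_lt1// ltr1n.
by have [N hN] := geometric_eventually_le C h e0; exists N; exact: hN.
Qed.

End calculus.

(** * Coordinates of the coefficients *)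

Section coefficients.
Context {R : realType} {m : nat}.

(** One finite index for the scalar coefficients, in the order d, a, beta, c; bounds, almost
    periodicity and limits are then stated once for all of them. *)
Definition coef_index : finType := ((('I_m + 'I_m * 'I_m) + 'I_m) + 'I_m)%type.

Definition coef_proj (j : coef_index) (x : coef_space R m) : R :=
  match j with
  | inl (inl (inl i)) => x.1.1.1 0 i
  | inl (inl (inr ik)) => x.1.1.2 ik.1 ik.2
  | inl (inr i) => x.1.2 0 i
  | inr i => x.2 0 i
  end.

Definition coef_of (f : coef_index -> R) : coef_space R m :=
  (\row_i f (inl (inl (inl i))), \matrix_(i, k) f (inl (inl (inr (i, k)))),
   \row_i f (inl (inr i)), \row_i f (inr i)).

Lemma coef_projK f j : coef_proj j (coef_of f) = f j.
Proof.
by case: j => [[[i|[i k]]|i]|i]; rewrite /coef_proj /coef_of /= !mxE.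
Qed.

Lemma coef_projB j x y : coef_proj j (x - y) = coef_proj j x - coef_proj j y.
Proof. by case: j => [[[i|[i k]]|i]|i]; rewrite /coef_proj /= !mxE. Qed.

Lemma coef_norm_leP (x : coef_space R m) e : 0 <= e ->
  (forall j, `|coef_proj j x| <= e) <-> `|x| <= e.
Proof.
move=> e0.
have mxn p q (M : 'M[R]_(p, q)) : `|M| <= e <-> forall i j, `|M i j| <= e.
  rewrite /Num.norm/= mx_normrE; split=> [h i j|h].
    apply: le_trans h.
    exact: (@le_bigmax _ _ _ _ (fun ij => `|M ij.1 ij.2|) (i, j)).
  by apply: bigmax_le => // -[i j] _; exact: h.
rewrite !prod_normE !ge_max; split=> [h|/andP[/andP[/andP[h1 h2] h3] h4]].
  apply/andP; split; [apply/andP; split; [apply/andP; split|]|];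
    apply/mxn => i j; rewrite ?(ord1 i).
  - exact: (h (inl (inl (inl j)))).
  - exact: (h (inl (inl (inr (i, j))))).
  - exact: (h (inl (inr j))).
  - exact: (h (inr j)).
case=> [[[i|[i k]]|i]|i] /=.
- by move/mxn : h1; exact.
- by move/mxn : h2; exact.
- by move/mxn : h3; exact.
- by move/mxn : h4; exact.
Qed.

Lemma coef_projB_le j x y : `|coef_proj j x - coef_proj j y| <= `|x - y|.
Proof.
by rewrite -coef_projB; exact: (coef_norm_leP _ (normr_ge0 _)).2 (lexx _) j.
Qed.

Lemma cvg_coefP T (F : set_system T) {FF : Filter F} (f : T -> coef_space R m)
    (x : coef_space R m) :
  f @ F --> x <-> forall j, coef_proj j (f p) @[p --> F] --> coef_proj j x.
Proof.
split=> [h j|h]; apply/cvgrPdist_le => e e0.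
  move/cvgrPdist_le : h => /(_ e e0); apply: filterS => p.
  exact/le_trans/coef_projB_le.
have : \forall p \near F, forall j, `|coef_proj j x - coef_proj j (f p)| <= e.
  apply: filter_forall => j.
  by move/cvgrPdist_le : (h j) => /(_ e e0).
apply: filterS => p H; apply/coef_norm_leP; first exact: ltW.
by move=> j; rewrite coef_projB.
Qed.

Lemma flowE t (w : coef_fun R m) s : flow t w s = w (t + s).
Proof. by []. Qed.

Lemma coef_dE (w : coef_fun R m) t i :
  coef_d (flow t w) i = coef_proj (inl (inl (inl i))) (w t).
Proof. by rewrite /coef_d flowE addr0. Qed.

Lemma coef_aE (w : coef_fun R m) t i k :
  coef_a (flow t w) i k = coef_proj (inl (inl (inr (i, k)))) (w t).
Proof. by rewrite /coef_a flowE addr0. Qed.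

Lemma coef_betaE (w : coef_fun R m) t i :
  coef_beta (flow t w) i = coef_proj (inl (inr i)) (w t).
Proof. by rewrite /coef_beta flowE addr0. Qed.

Lemma coef_cE (w : coef_fun R m) t i :
  coef_c (flow t w) i = coef_proj (inr i) (w t).
Proof. by rewrite /coef_c flowE addr0. Qed.

Lemma coef_proj_continuous j (w : coef_fun R m) :
  continuous (fun t => coef_proj j (w t)).
Proof.
by move=> t; apply: (cvg_coefP _ _).1; exact: cts_fun.
Qed.

Variable r : 'I_m -> R.

Lemma nicholson_rhsE (w : coef_fun R m) (y : 'I_m -> R -> R) i t :
  nicholson_rhs r w y i t =
  - coef_proj (inl (inl (inl i))) (w t) * y i t
  + \sum_k coef_proj (inl (inl (inr (i, k)))) (w t) * y k t
  + coef_proj (inl (inr i)) (w t) * y i (t - r i)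
    * expR (- coef_proj (inr i) (w t) * y i (t - r i)).
Proof.
rewrite /nicholson_rhs coef_dE coef_betaE coef_cE.
by under eq_bigr do rewrite coef_aE.
Qed.

(** Coefficients, solution and time all move along the same filter. This covers continuity in time
    as well as the limit of the equations along a product filter. *)
Lemma nicholson_rhs_cvg T (F : set_system T) {FF : Filter F}
    (w : T -> coef_fun R m) (y : T -> 'I_m -> R -> R) (s : T -> R)
    (w0 : coef_fun R m) (y0 : 'I_m -> R -> R) (t : R) i :
  (forall j, coef_proj j (w p (s p)) @[p --> F] --> coef_proj j (w0 t)) ->
  (forall k, y p k (s p) @[p --> F] --> y0 k t) ->
  y p i (s p - r i) @[p --> F] --> y0 i (t - r i) ->
  nicholson_rhs r (w p) (y p) i (s p) @[p --> F] --> nicholson_rhs r w0 y0 i t.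
Proof.
move=> cw cy cyr; under eq_fun do rewrite nicholson_rhsE.
rewrite nicholson_rhsE.
apply: cvgD.
  apply: cvgD; first by apply: cvgM; [apply: cvgN|].
  apply: cvg_big => [|k _]; last exact: cvgM.
  by move=> x; exact: add_continuous.
apply: cvgM; first exact: cvgM.
apply: continuous_cvg; first exact: continuous_expR.
by apply: cvgM; [exact: cvgN|].
Qed.

Lemma nicholson_rhs_continuous (w : coef_fun R m) (y : 'I_m -> R -> R) i :
  (forall k, continuous (y k)) -> continuous (nicholson_rhs r w y i).
Proof.
move=> cy t; apply: (@nicholson_rhs_cvg _ (nbhs t) _ (fun=> w) (fun=> y) id).
- by move=> j; exact: coef_proj_continuous.
- by move=> k; exact: cy.
apply: (@continuous_comp _ _ _ (fun s => s - r i) (y i)); last exact: cy.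
by apply: cvgB; [exact: cvg_id|exact: cvg_cst].
Qed.

End coefficients.

(** * Existence and uniqueness for the delay equation *)

Section initial_value_problem.
Context {R : realType} {m : nat} (r : 'I_m -> R).
Implicit Types (w : coef_fun R m) (y z phi : 'I_m -> R -> R).

Definition admissible (K : R) w := forall j t, 0 <= coef_proj j (w t) <= K.

(* Adding K * y to the right-hand side makes it nonnegative for y >= 0, so that
   Picard iterates of the variation of constants formula stay nonnegative. *)
Definition shifted_rhs (K : R) w y i t := K * y i t + nicholson_rhs r w y i t.

Lemma shifted_rhs_ge0 (K : R) w y i (t : R) : admissible K w ->
  (forall i t, 0 <= y i t) -> 0 <= shifted_rhs K w y i t.
Proof.
move=> wK y0; rewrite /shifted_rhs nicholson_rhsE.
rewrite !addrA -mulrDl !addr_ge0//.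
- by rewrite mulr_ge0// subr_ge0; have /andP[] := wK (inl (inl (inl i))) t.
- apply: sumr_ge0 => k _; rewrite mulr_ge0//.
  by have /andP[] := wK (inl (inl (inr (i, k)))) t.
- rewrite !mulr_ge0 ?expR_ge0//.
  by have /andP[] := wK (inl (inr i)) t.
Qed.

(** The factor [m.+1] counts d_i and the m entries a_ik; the exponential is the Lipschitz constant
    of the delayed term. B = 0 serves nonnegative functions, B > 0 serves uniqueness, where no sign
    is known. *)
Lemma nicholson_rhs_lipschitz (K B : R) w y z i (t b b' : R) :
  admissible K w -> 0 <= B ->
  - B <= y i (t - r i) -> - B <= z i (t - r i) ->
  (forall k, `|y k t - z k t| <= b) ->
  `|y i (t - r i) - z i (t - r i)| <= b' ->
  `|nicholson_rhs r w y i t - nicholson_rhs r w z i t| <=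
  K * (m.+1%:R * b + expR (2 * (K * B)) * b').
Proof.
move=> wK B0 yB zB yz yzr; rewrite !nicholson_rhsE.
have wKn j : `|coef_proj j (w t)| <= K.
  by have /andP[? ?] := wK j t; rewrite ger0_norm.
have wK0 j : 0 <= coef_proj j (w t) by have /andP[] := wK j t.
have b0 : 0 <= b by apply: le_trans (yz i).
have K0 : 0 <= K.
  by move: (wK (inr i) t) => /andP[/le_trans]; apply.
set D := coef_proj (inl (inl (inl i))) (w t).
set b1 := coef_proj (inl (inr i)) (w t); set c := coef_proj (inr i) (w t).
set u := y i (t - r i); set v := z i (t - r i).
set S := \sum_k _; set S' := \sum_k _.
have -> : - D * y i t + S + b1 * u * expR (- c * u) -
  (- D * z i t + S' + b1 * v * expR (- c * v)) =
  - D * (y i t - z i t) + (S - S') +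
  b1 * (u * expR (- c * u) - v * expR (- c * v)) by ring.
have hD : `|- D * (y i t - z i t)| <= K * b.
  by rewrite normrM normrN; apply: ler_pM => //; exact: wKn.
have hS : `|S - S'| <= K * (m%:R * b).
  rewrite -sumrB; apply: le_trans (ler_norm_sum _ _ _) _.
  apply: (@le_trans _ _ (\sum_(k < m) K * b)).
    by apply: ler_sum => k _; rewrite -mulrBr normrM; apply: ler_pM.
  by rewrite sumr_const card_ord -mulr_natl; lra.
have hg : `|b1 * (u * expR (- c * u) - v * expR (- c * v))| <=
    K * (expR (2 * (K * B)) * b').
  rewrite normrM; apply: ler_pM => //; first exact: wKn.
  apply: (@le_trans _ _ (expR (2 * (K * B)) * `|u - v|)).
    by apply: ricker_lipschitz => //; have := wK (inr i) t.
  by rewrite ler_wpM2l ?expR_ge0.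
have := ler_normD (- D * (y i t - z i t) + (S - S'))
  (b1 * (u * expR (- c * u) - v * expR (- c * v))).
have := ler_normD (- D * (y i t - z i t)) (S - S').
rewrite -natr1 => h1 h2.
apply: (le_trans h2); lra.
Qed.

(** * The Picard map of the variation of constants formula *)

Section picard.
Variables (K : R) (w : coef_fun R m) (phi : 'I_m -> R -> R).
Hypotheses (K0 : 0 < K) (wK : admissible K w) (r_ge0 : forall i, 0 <= r i).
Hypotheses (phi_cont : forall i, continuous (phi i))
  (phi_ge0 : forall i t, 0 <= phi i t).

(** For t >= 0 this is z(t) = e^(- K t) (phi(0) + int_0^t e^(K s) (K y + rhs)(s) ds), for t <= 0 it
    is phi(t); the truncations of t merge both cases. It is a relation because G is only known to
    exist. *)
Definition picard_image y z := exists G : 'I_m -> R -> R,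
  [/\ forall i, G i 0 = 0,
      forall i (t : R), -1 < t ->
        is_derive t 1 (G i) (expR (K * t) * shifted_rhs K w y i t) &
      forall i t, z i t =
        expR (- K * Num.max t 0) * (phi i (Num.min t 0) + G i (Num.max t 0))].

Lemma shifted_rhs_continuous y i : (forall k, continuous (y k)) ->
  continuous (shifted_rhs K w y i).
Proof.
move=> cy t; apply: cvgD; last exact: nicholson_rhs_continuous.
by apply: cvgM; [exact: cvg_cst|exact: cy].
Qed.

Lemma picard_image_exists y : (forall k, continuous (y k)) ->
  exists z, picard_image y z.
Proof.
move=> cy.
have /choice[G hG] : forall i, exists G : R -> R, G 0 = 0 /\
    forall t : R, -1 < t ->
      is_derive t 1 G (expR (K * t) * shifted_rhs K w y i t).
  move=> i; apply: antiderivative => t.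
  apply: cvgM; first exact: continuous_expRM.
  exact: shifted_rhs_continuous.
eexists; exists G; split=> [i|i|i t]; last reflexivity.
  exact: (hG i).1.
exact: (hG i).2.
Qed.

Let max0_continuous : continuous (fun t : R => Num.max t 0).
Proof.
move=> t; apply: (@continuous_max _ _ id (cst 0)); first exact: cvg_id.
exact: cvg_cst.
Qed.

Let min0_continuous : continuous (fun t : R => Num.min t 0).
Proof.
move=> t; apply: (@continuous_min _ _ id (cst 0)); first exact: cvg_id.
exact: cvg_cst.
Qed.

Lemma picard_image_continuous y z : picard_image y z ->
  forall i, continuous (z i).
Proof.
move=> [G [_ dG zE]] i; rewrite (funext (zE i)) => t; apply: cvgM.
  apply: (@continuous_comp _ _ _ (fun t : R => Num.max t 0)
    (fun t => expR (- K * t))).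
    exact: max0_continuous.
  exact: continuous_expRM.
apply: cvgD.
  apply: (@continuous_comp _ _ _ (fun t : R => Num.min t 0) (phi i)).
    exact: min0_continuous.
  exact: phi_cont.
apply: (@continuous_comp _ _ _ (fun t : R => Num.max t 0) (G i)).
  exact: max0_continuous.
have t1 : -1 < Num.max t 0 by rewrite lt_max ltrN10 orbT.
exact: is_derive_continuous (dG i _ t1).
Qed.

Let G_increment (G : R -> R) (g : R -> R) (h h' : R -> R) t : 0 <= t ->
  (forall s : R, -1 < s -> is_derive s 1 G (g s)) ->
  (forall s : R, is_derive s 1 h (h' s)) ->
  (forall s, 0 < s -> `|g s| <= h' s) ->
  `|G t - G 0| <= h t - h 0.
Proof.
move=> t0 dG dh gh; apply: (@normr_increment_le _ G g h h') => //.
- apply: continuous_in_subspaceT => s; rewrite inE/= in_itv/= => /andP[s0 _].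
  have s1 : -1 < s by lra.
  exact: is_derive_continuous (dG s s1).
- apply: continuous_subspaceT => s; exact: is_derive_continuous (dh s).
- by move=> s /andP[s0 _]; apply: dG; lra.
- by move=> s /andP[s0 _]; apply: gh.
Qed.

Lemma picard_image_ge0 y z : picard_image y z ->
  (forall i t, 0 <= y i t) -> forall i t, 0 <= z i t.
Proof.
move=> [G [G0 dG zE]] y0 i t; rewrite zE mulr_ge0 ?expR_ge0// addr_ge0//.
rewrite -[leLHS](G0 i).
apply: (@derivative_ge0_le _ (G i)
  (fun t => expR (K * t) * shifted_rhs K w y i t)).
- by rewrite le_max lexx orbT.
- apply: continuous_in_subspaceT => s; rewrite inE/= in_itv/= => /andP[s0 _].
  have s1 : -1 < s by lra.
  exact: is_derive_continuous (dG i s s1).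
- move=> s /andP[s0 _]; apply: dG; lra.
- by move=> s _; rewrite mulr_ge0 ?expR_ge0// shifted_rhs_ge0.
Qed.

Lemma picard_image_history y z i t : picard_image y z -> t <= 0 ->
  z i t = phi i t.
Proof.
move=> [G [G0 dG zE]] t0.
by rewrite zE (max_idPr t0) (min_idPl t0) mulr0 expR0 mul1r G0 addr0.
Qed.

(** Twice the Lipschitz constant K (m + 3) of [shifted_rhs] on nonnegative functions: K from the
    shift, K (m + 1) from the undelayed terms, K from the delayed one. *)
Definition picard_rate : R := 2 * K * (m%:R + 3).

Lemma picard_rate_gt0 : 0 < picard_rate.
Proof. by rewrite !mulr_gt0// ltr_wpDl. Qed.

(** In the norm weighted by e^(- [picard_rate] max(t, 0)) the Picard map contracts by 1/2, on the
    whole half-line at once. *)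
Lemma picard_contraction (M : R) y z y' z' :
  picard_image y z -> picard_image y' z' ->
  (forall i t, 0 <= y i t) -> (forall i t, 0 <= y' i t) ->
  (forall i t, `|y i t - y' i t| <= M * expR (picard_rate * Num.max t 0)) ->
  forall i t, `|z i t - z' i t| <= M / 2 * expR (picard_rate * Num.max t 0).
Proof.
move=> [G [G0 dG zE]] [G' [G0' dG' zE']] y0 y0' yM i t.
have M0 : 0 <= M.
  have := le_trans (normr_ge0 _) (yM i t).
  by rewrite pmulr_lge0// expR_gt0.
rewrite zE zE' -mulrBr opprD addrACA subrr add0r normrM ger0_norm ?expR_ge0//.
have t0 : 0 <= Num.max t 0 by rewrite le_max lexx orbT.
move: (Num.max t 0) t0 => {}t t0.
rewrite mulNr expRN ler_pdivrMl ?expR_gt0//.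
set la := picard_rate.
have la0 : 0 < la := picard_rate_gt0.
(* Its derivative dominates the difference of the two integrands; the factor e^(K t) is cancelled by
   the prefactor e^(- K t) of the formula. *)
pose h s := M / 2 * expR ((K + la) * s).
have dh (s : R) : is_derive s 1 h (M / 2 * ((K + la) * expR ((K + la) * s))).
  exact: is_deriveZ (is_derive_expRM _ _).
have step : `|(G i - G' i) t - (G i - G' i) 0| <= h t - h 0.
  apply: (@G_increment _ (fun t => expR (K * t) * shifted_rhs K w y i t -
    expR (K * t) * shifted_rhs K w y' i t) _ _ t t0 _ dh) => [s s1|s s0].
    have := dG i s s1; have := dG' i s s1 => *; exact: is_deriveB.
  rewrite -mulrBr normrM ger0_norm ?expR_ge0// /shifted_rhs.
  set E := expR (la * s).
  have yM' k : `|y k s - y' k s| <= M * E.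
    by have := yM k s; rewrite (max_idPl (ltW s0)).
  (* The weight is nondecreasing in time, so the delayed value obeys the bound valid at time s,
     whether or not s - r_i is negative. *)
  have yMr : `|y i (s - r i) - y' i (s - r i)| <= M * E.
    apply: le_trans (yM i (s - r i)) _.
    rewrite ler_wpM2l// ler_expR -/la ler_pM2l//.
    by rewrite ge_max (ltW s0) andbT gerBl.
  have := @nicholson_rhs_lipschitz K 0 w y y' i s _ _ wK (lexx 0) _ _ yM' yMr.
  rewrite oppr0 y0 y0' !mulr0 expR0 => /(_ isT isT) hl.
  have hK : `|K * y i s - K * y' i s| <= K * (M * E).
    by rewrite -mulrBr normrM gtr0_norm// ler_wpM2l// ltW.
  apply: (@le_trans _ _ (expR (K * s) * (la / 2 * (M * E)))).
    rewrite ler_wpM2l ?expR_ge0//.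
    have := ler_normD (K * y i s - K * y' i s)
      (nicholson_rhs r w y i s - nicholson_rhs r w y' i s).
    rewrite addrACA -opprD => /le_trans; apply.
    move: hl hK; rewrite -natr1 mul1r /la /picard_rate; lra.
  rewrite (mulrDl K la s) expRD -/E.
  have e1 := expR_ge0 (K * s).
  have e2 : 0 <= E by exact: expR_ge0.
  have : 0 <= M / 2 * (K * (expR (K * s) * E)).
    by rewrite !mulr_ge0// ltW.
  lra.
have : h t - h 0 <= h t by rewrite gerBl /h mulr_ge0 ?expR_ge0// divr_ge0.
move: step; rewrite !fctE G0 G0' subrr subr0 => step /(le_trans step).
by rewrite /h mulrDl expRD mulrCA.
Qed.

End picard.
End initial_value_problem.

(** * Global existence of nonnegative solutions *)

Section existence.
Context {R : realType} {m : nat} (r : 'I_m -> R).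
Variables (K : R) (w : coef_fun R m) (phi : 'I_m -> R -> R) (B : R).
Hypotheses (K0 : 0 < K) (wK : admissible K w) (r_ge0 : forall i, 0 <= r i).
Hypotheses (phi_cont : forall i, continuous (phi i))
  (phi_bounds : forall i t, 0 <= phi i t <= B).

Let phi_ge0 i t : 0 <= phi i t. Proof. by case/andP: (phi_bounds i t). Qed.

Let la := picard_rate (m := m) K.

Lemma picard_iterates_exist : exists Y : nat -> 'I_m -> R -> R,
  [/\ forall n i, continuous (Y n i), forall n i t, 0 <= Y n i t,
      forall n, picard_image r K w phi (Y n) (Y n.+1) &
      forall n i t, `|Y n.+1 i t - Y n i t| <=
        B / 2 * expR (la * Num.max t 0) * 2^-1 ^+ n].
Proof.
have /choice[next hnext] : forall y : 'I_m -> R -> R, exists z,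
    (forall k, continuous (y k)) -> picard_image r K w phi y z.
  move=> y; have [cy|ncy] := pselect (forall k, continuous (y k)).
    by have [z hz] := picard_image_exists r K w phi cy; exists z.
  by exists y => cy.
(* The Picard image of the zero function. Its distance to 0 is at most B in the weighted norm, which
   starts the chain of contractions. *)
pose Y0 i t : R := expR (- K * Num.max t 0) * (phi i (Num.min t 0) + 0).
have hY0 : picard_image r K w phi (fun _ _ => 0) Y0.
  exists (fun _ => cst 0); split => // i t _.
  apply: is_derive_eq; rewrite /shifted_rhs nicholson_rhsE !mulr0 mul0r !add0r.
  by rewrite big1 ?addr0 ?mulr0// => k _; rewrite mulr0.
pose Y n := iter n next Y0.
have cY n i : continuous (Y n i).
  elim: n i => [|n IH] i; first exact: (picard_image_continuous phi_cont hY0).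
  exact: (picard_image_continuous phi_cont (hnext _ IH)).
have Y_ge0 n i t : 0 <= Y n i t.
  elim: n i t => [|n IH] i t.
    by apply: (picard_image_ge0 wK phi_ge0 hY0).
  exact: (picard_image_ge0 wK phi_ge0 (hnext _ (cY n))).
have pY n : picard_image r K w phi (Y n) (Y n.+1) by apply: hnext; exact: cY.
have Y0B i t : `|Y 0 i t - 0| <= B * expR (la * Num.max t 0).
  rewrite subr0 ger0_norm// /Y /= /Y0 addr0 mulrC.
  apply: ler_pM => //; first by case/andP: (phi_bounds i (Num.min t 0)).
  rewrite ler_expR mulNr (@le_trans _ _ 0)//.
    by rewrite oppr_le0 mulr_ge0 ?le_max ?lexx ?orbT// ltW.
  by rewrite mulr_ge0 ?le_max ?lexx ?orbT// ltW// picard_rate_gt0.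
have pc := picard_contraction K0 wK r_ge0.
exists Y; split => // n; elim: n => [|n IH] i t.
  rewrite expr0 mulr1; exact: (pc _ _ _ _ _ _ (pY 0) hY0).
rewrite exprS.
have H : forall i t, `|Y n.+1 i t - Y n i t| <=
    (B / 2 * 2^-1 ^+ n) * expR (la * Num.max t 0).
  by move=> i' t'; apply: le_trans (IH i' t') _; rewrite mulrAC.
apply: le_trans (pc _ _ _ _ _ _ (pY n.+1) (pY n) _ _ H i t) _ => //.
by rewrite le_eqVlt; apply/orP; left; apply/eqP; rewrite -/la; ring.
Qed.

Lemma picard_fixpoint_exists : exists y : 'I_m -> R -> R,
  [/\ forall i, continuous (y i), forall i t, 0 <= y i t &
      picard_image r K w phi y y].
Proof.
have [Y [cY Y0 pY dY]] := picard_iterates_exist.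
pose E t := expR (la * Num.max t 0).
have /choice[y hy] : forall i, exists f : R -> R, forall t k,
    `|Y k i t - f t| <= B * E t * 2^-1 ^+ k.
  move=> i; have /choice[f hf] : forall t, exists l, forall k,
      `|Y k i t - l| <= 2 * (B / 2 * E t) * 2^-1 ^+ k.
    by move=> t; apply: geometric_cauchy_limit => k; exact: dY.
  exists f => t k; apply: le_trans (hf t k) _.
  by rewrite le_eqVlt; apply/orP; left; apply/eqP; field.
have E_le (t s : R) : t <= s -> E t <= E s.
  move=> ts; rewrite ler_expR ler_pM2l ?picard_rate_gt0//.
  by rewrite ge_max !le_max ts lexx orbT.
have y_cont i : continuous (y i).
  move=> t; apply/cvgrPdist_le => e e0.
  have e3 : 0 < e / 3 by rewrite divr_gt0.
  (* E is nondecreasing, so the error bound at t + 1 is uniform on a neighbourhood of t. *)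
  have [k hk] := halfpow_eventually_le (B * E (t + 1)) e3.
  have near_le (s : R) : s <= t + 1 -> `|Y k i s - y i s| <= e / 3.
    move=> st; apply: le_trans (hy i s k) _; apply: le_trans _ hk.
    have B0 : 0 <= B by case/andP: (phi_bounds i 0); exact: le_trans.
    by rewrite ler_wpM2r ?exprn_ge0// ler_wpM2l// E_le.
  have := cY k i t; move/cvgrPdist_le => /(_ _ e3) ck.
  near=> s.
  have h1 : `|Y k i t - Y k i s| <= e / 3 by near: s.
  have st : s <= t + 1 by apply: ltW; near: s; apply: lt_nbhsl; rewrite ltrDl.
  have h2 := near_le _ st.
  have h3 : `|Y k i t - y i t| <= e / 3 by apply: near_le; lra.
  have -> : y i t - y i s = (Y k i t - Y k i s) - (Y k i t - y i t)
    + (Y k i s - y i s) by ring.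
  apply: le_trans (ler_normD _ _) _.
  have := ler_normB (Y k i t - Y k i s) (Y k i t - y i t); lra.
have y_ge0 i t : 0 <= y i t.
  rewrite leNgt; apply/negP => yt.
  have yt2 : 0 < - y i t / 2 by lra.
  have [k hk] := halfpow_eventually_le (B * E t) yt2.
  have := Y0 k i t; have := le_trans (hy i t k) hk.
  by rewrite ler_norml => /andP[_ ?] ?; lra.
(* By contraction [Y k.+1] is close to this image z of y, but it also converges to y; hence z =
   y. *)
have [z pz] := picard_image_exists r K w phi y_cont.
exists y; split => //.
suff yz : y = z by rewrite [X in picard_image _ _ _ _ _ X]yz.
apply/funext => i; apply/funext => t.
apply/eqP; rewrite -subr_eq0 -normr_le0; apply/ler_addgt0Pl => e e0.
rewrite addr0.
have e2 : 0 < e / 2 by rewrite divr_gt0.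
have [k hk] := halfpow_eventually_le (B * E t) e2.
have h1 : `|Y k.+1 i t - y i t| <= e / 2.
  apply: le_trans (hy i t k.+1) _; apply: le_trans _ hk.
  have B0 : 0 <= B by case/andP: (phi_bounds i 0); exact: le_trans.
  rewrite ler_wpM2l ?mulr_ge0 ?expR_ge0// exprS ler_piMl ?exprn_ge0//.
  by rewrite invf_le1// ler1n.
have h2 : `|Y k.+1 i t - z i t| <= e / 2.
  have H i' t' : `|Y k i' t' - y i' t'| <=
      (B * 2^-1 ^+ k) * expR (la * Num.max t' 0).
    by apply: le_trans (hy i' t' k) _; rewrite mulrAC.
  have := picard_contraction K0 wK r_ge0 (pY k) pz (Y0 k) y_ge0 H i t.
  move=> /le_trans; apply.
  rewrite -/la -/(E t); apply: le_trans _ hk.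
  have B0 : 0 <= B by case/andP: (phi_bounds i 0); exact: le_trans.
  have : 0 <= B * E t * 2^-1 ^+ k by rewrite !mulr_ge0 ?expR_ge0 ?exprn_ge0.
  lra.
have -> : y i t - z i t = (Y k.+1 i t - z i t) - (Y k.+1 i t - y i t) by ring.
apply: le_trans (ler_normB _ _) _; lra.
Unshelve. all: by end_near. Qed.

Lemma nicholson_solution_exists : exists y : 'I_m -> R -> R,
  [/\ forall i, continuous (y i), forall i t, 0 <= y i t,
      forall i t, t <= 0 -> y i t = phi i t,
      forall i (t : R), 0 < t -> is_derive t 1 (y i) (nicholson_rhs r w y i t) &
      forall i, h^-1 * (y i h - y i 0) @[h --> 0^'+] -->
        nicholson_rhs r w y i 0].
Proof.
have [y [cy y0 py]] := picard_fixpoint_exists.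
have yphi i t := @picard_image_history _ _ _ _ _ _ _ _ i t py.
have [G [G0 dG yE]] := py.
(* The formula without truncation agrees with y for t >= 0 and is differentiable across 0, which y
   need not be; it yields the right derivative of y at 0. *)
pose z i (t : R) := expR (- K * t) * (phi i 0 + G i t).
have yz i t : 0 <= t -> y i t = z i t.
  by move=> t0; rewrite yE /z (max_idPl t0) (min_idPr t0).
have dz i (t : R) : 0 <= t -> is_derive t 1 (z i) (nicholson_rhs r w y i t).
  move=> t0; have t1 : -1 < t by lra.
  have d1 := is_derive_expRM (- K) t.
  have d2 : is_derive t 1 (fun s => phi i 0 + G i s)
      (0 + expR (K * t) * shifted_rhs r K w y i t).
    by have ? := dG i t t1; exact: is_deriveD.
  have dzt := is_deriveM d1 d2; apply: is_derive_eq dzt _.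
  rewrite /GRing.scale/= add0r mulrA -expRD mulNr addNr expR0 mul1r.
  rewrite /shifted_rhs (yz _ _ t0) /z mulNr; ring.
exists y; split => // i.
  move=> t t0; apply: near_eq_is_derive (dz i t (ltW t0)).
  near=> s; apply/esym/yz/ltW; near: s; exact: lt_nbhsr.
have := is_derive_right_slope (dz i 0 (lexx 0)).
apply: cvg_trans; apply: near_eq_cvg; near=> h.
by rewrite add0r !yz.
Unshelve. all: by end_near. Qed.

End existence.

(** * Uniqueness among solutions of arbitrary sign *)

Section uniqueness.
Context {R : realType} {m : nat} (r : 'I_m -> R) (K : R) (w : coef_fun R m).
Hypotheses (K0 : 0 < K) (wK : admissible K w) (r_ge0 : forall i, 0 <= r i).

Lemma within_itvcy_bounded (y : 'I_m -> R -> R) (T : R) :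
  (forall i, {within `[- r i, +oo[, continuous (y i)}) ->
  exists2 B : R, 0 <= B & forall i t, - r i <= t <= T -> `|y i t| <= B.
Proof.
move=> cy.
have /choice[B hB] : forall i, exists B, forall t, t \in `[- r i, T] ->
    `|y i t| <= B.
  move=> i; apply: within_itvcc_bounded.
  apply: continuous_subspaceW (cy i) => t /=; rewrite !in_itv/= andbT.
  by case/andP.
exists (\sum_i `|B i|) => [|i t tT]; first by rewrite sumr_ge0.
have := hB i t; rewrite in_itv/= tT => /(_ isT)/le_trans; apply.
by rewrite (bigD1 i)//= (le_trans (ler_norm _))// lerDl sumr_ge0.
Qed.

(** Each integration halves the bound on |y - z| in a weighted norm, as in the Picard estimate. The
    time T is fixed beforehand: the bound B of both solutions up to T determines the Lipschitz
    constant and the weight. *)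
Lemma nicholson_solution_unique (y z : 'I_m -> R -> R) :
  (forall i, {within `[- r i, +oo[, continuous (y i)}) ->
  (forall i, {within `[- r i, +oo[, continuous (z i)}) ->
  (forall i (t : R), 0 < t -> is_derive t 1 (y i) (nicholson_rhs r w y i t)) ->
  (forall i (t : R), 0 < t -> is_derive t 1 (z i) (nicholson_rhs r w z i t)) ->
  (forall i t, - r i <= t <= 0 -> y i t = z i t) ->
  forall i t, - r i <= t -> y i t = z i t.
Proof.
move=> cy cz dy dz yz0 i0 T T0.
have [By By0 hBy] := within_itvcy_bounded T cy.
have [Bz Bz0 hBz] := within_itvcy_bounded T cz.
pose B := By + Bz.
have B0 : 0 <= B by rewrite addr_ge0.
pose E := expR (2 * (K * B)).
pose la := 2 * (K * (m.+1%:R + E)).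
have la0 : 0 < la by rewrite !mulr_gt0// addr_gt0 ?expR_gt0// ltr0Sn.
have claim n : forall i t, - r i <= t <= T ->
    `|y i t - z i t| <= B * 2^-1 ^+ n * expR (la * Num.max t 0).
  elim: n => [|n IH] i t tT.
    rewrite expr0 mulr1 (@le_trans _ _ B)//.
      by rewrite (le_trans (ler_normB _ _))// lerD// ?hBy ?hBz.
    rewrite ler_peMr// -expR0 ler_expR mulr_ge0// ?(ltW la0)//.
    by rewrite le_max lexx orbT.
  have [t0|t0] := leP t 0.
    rewrite yz0; last by case/andP: tT => ->.
    by rewrite subrr normr0 !mulr_ge0 ?exprn_ge0 ?expR_ge0.
  have yz00 : y i 0 - z i 0 = 0.
    by rewrite yz0 ?subrr// lexx oppr_le0 r_ge0.
  set M := B * 2^-1 ^+ n.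
  have M0 : 0 <= M by rewrite mulr_ge0 ?exprn_ge0.
  pose g s := M / 2 * expR (la * s).
  have dg (s : R) : is_derive s 1 g (M / 2 * (la * expR (la * s))).
    exact: is_deriveZ (is_derive_expRM _ _).
  have sub : `[0, t] `<=` `[- r i, +oo[.
    move=> s /=; rewrite !in_itv/= andbT => /andP[s0 _].
    by rewrite (le_trans _ s0)// oppr_le0.
  have := @normr_increment_le _ (y i - z i)
    (fun s => nicholson_rhs r w y i s - nicholson_rhs r w z i s) g _ 0 t
    (ltW t0) _ _ _ (fun s _ => dg s).
  rewrite !fctE yz00 subr0 => H.
  apply: le_trans (H _ _ _ _) _.
  - move=> s; apply: cvgB.
      exact: (continuous_subspaceW sub (cy i)).
    exact: (continuous_subspaceW sub (cz i)).
  - by apply: continuous_subspaceT => s; exact: is_derive_continuous (dg s).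
  - move=> s /andP[s0 _]; have := dy i s s0; have := dz i s s0 => *.
    exact: is_deriveB.
  - move=> s /andP[s0 st]; case/andP: tT => _ tT.
    have sT : s <= T by rewrite (le_trans (ltW st)).
    have b k : `|y k s - z k s| <= M * expR (la * s).
      have := IH k s; rewrite (max_idPl (ltW s0)); apply.
      by rewrite sT andbT (le_trans _ (ltW s0))// oppr_le0.
    have sr : - r i <= s - r i <= T.
      by rewrite lerDr (ltW s0)/= (le_trans _ sT)// gerBl.
    have b' : `|y i (s - r i) - z i (s - r i)| <= M * expR (la * s).
      apply: le_trans (IH i _ sr) _; rewrite ler_wpM2l// ler_expR ler_pM2l//.
      by rewrite ge_max (ltW s0) andbT gerBl.
    have yB : - B <= y i (s - r i).
      have := hBy i _ sr; rewrite ler_norml /B; lra.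
    have zB : - B <= z i (s - r i).
      have := hBz i _ sr; rewrite ler_norml /B; lra.
    apply: le_trans (nicholson_rhs_lipschitz wK B0 yB zB b b') _.
    by rewrite le_eqVlt; apply/orP; left; apply/eqP; rewrite /la -/E; field.
  rewrite exprS /g (_ : B * _ = M / 2); last by rewrite /M; field.
  by rewrite gerBl mulr_ge0 ?expR_ge0 ?divr_ge0.
have [TT|] := leP (- r i0) T; last by rewrite ltNge T0.
apply/eqP; rewrite -subr_eq0 -normr_le0; apply/ler_addgt0Pl => e e0.
rewrite addr0.
have [n hn] := halfpow_eventually_le (B * expR (la * Num.max T 0)) e0.
apply: le_trans (claim n i0 T _) _; first by rewrite T0 lexx.
by rewrite mulrAC.
Qed.

End uniqueness.

(** * Segments of solutions and evaluation of the semiflow *)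

Section segments.
Context {R : realType} {m : nat} {r : 'I_m -> R}.
Implicit Types (y : 'I_m -> R -> R) (phi : history r).

Lemma segment_continuous y t i (cy : forall i, continuous (y i)) :
  continuous (fun s : set_type `[- r i, 0]%classic => y i (t + set_val s)).
Proof.
move=> s; apply: (@continuous_comp _ _ _ set_val (fun s => y i (t + s))).
  exact: initial_continuous.
apply: (@continuous_comp _ _ _ (+%R t) (y i)); last exact: cy.
by apply: cvgD; [exact: cvg_cst|exact: cvg_id].
Qed.

Definition segment y (cy : forall i, continuous (y i)) t : history r :=
  fun i => mkcts (@segment_continuous y t i cy).

Lemma segmentE y (cy : forall i, continuous (y i)) t i
    (s : set_type `[- r i, 0]%classic) : segment cy t i s = y i (t + set_val s).
Proof. by []. Qed.

Lemma is_segment_uniq y t phi (cy : forall i, continuous (y i)) :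
  is_segment y t phi -> phi = segment cy t.
Proof.
move=> h; apply: functional_extensionality_dep => i; apply/continuousEP => s.
by rewrite h.
Qed.

Hypothesis r_ge0 : forall i, 0 <= r i.

Let clamp_in i (t : R) :
  Num.max (- r i) (Num.min t 0) \in (`[- r i, 0]%classic : set R).
Proof.
by rewrite inE/= in_itv/= le_max lexx/= ge_max ge_min lexx orbT oppr_le0 r_ge0.
Qed.

Definition history_clamp i (t : R) : set_type `[- r i, 0]%classic :=
  exist _ (Num.max (- r i) (Num.min t 0)) (clamp_in i t).

(** Constant continuation beyond both ends of [- r_i, 0]; it keeps continuity, sign and bounds. *)
Definition history_ext phi i (t : R) : R := phi i (history_clamp i t).

Lemma history_ext_continuous phi i : continuous (history_ext phi i).
Proof.
move=> t; apply: (@continuous_comp _ _ _ (history_clamp i) (phi i)).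
  apply: continuous_comp_initial => {}t.
  suff : {for t, continuous (cst (- r i) \max (id \min cst 0))} by [].
  apply: continuous_max; first exact: cvg_cst.
  by apply: continuous_min; [exact: cvg_id|exact: cvg_cst].
exact: cts_fun.
Qed.

Lemma history_extE phi i (s : set_type `[- r i, 0]%classic) :
  history_ext phi i (set_val s) = phi i s.
Proof.
congr (phi i _); apply: val_inj => /=.
have := set_valP s; rewrite /= in_itv/= => /andP[s1 s2].
by rewrite min_l// max_r.
Qed.

Lemma history_bounded phi : exists2 B, 0 <= B & forall i s, `|phi i s| <= B.
Proof.
have /choice[B hB] : forall i, exists B, forall s, `|phi i s| <= B.
  by move=> i; exact: itvcc_fun_bounded.
exists (\sum_i `|B i|) => [|i s]; first by rewrite sumr_ge0.
rewrite (le_trans (hB i s))// (bigD1 i)//=.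
by rewrite (le_trans (ler_norm _))// lerDl sumr_ge0.
Qed.

Variables (K : R) (K0 : 0 < K).

(** The solution prolongs [history_ext], so it is continuous and nonnegative on the whole line and
    its segments are defined at every time. *)
Lemma is_solution_exists (w : coef_fun R m) phi : admissible K w ->
  nonneg_cone r phi ->
  exists2 y, is_solution w phi y &
    (forall i, continuous (y i)) /\ (forall i t, 0 <= y i t).
Proof.
move=> wK phi0; have [B B0 hB] := history_bounded phi.
have phiB i t : 0 <= history_ext phi i t <= B.
  by apply/andP; split; [exact: phi0|exact: le_trans (ler_norm _) (hB _ _)].
have [y [cy y0 yphi dy dy0]] :=
  nicholson_solution_exists K0 wK r_ge0 (@history_ext_continuous phi) phiB.
exists y => //; split => //.
- move=> i s; rewrite add0r yphi ?history_extE//.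
  by have := set_valP s; rewrite /= in_itv/= => /andP[].
- by move=> i; exact: continuous_subspaceT.
Qed.

Lemma is_solution_uniq (w : coef_fun R m) phi y z : admissible K w ->
  is_solution w phi y -> is_solution w phi z ->
  forall i t, - r i <= t -> y i t = z i t.
Proof.
move=> wK [sy cy dy _] [sz cz dz _].
apply: (nicholson_solution_unique K0 wK r_ge0 cy cz dy dz) => i t tr.
have tr' : t \in (`[- r i, 0]%classic : set R) by rewrite inE/= in_itv.
by have := sy i (exist _ t tr'); rewrite sz/= !add0r.
Qed.

(** The choice made by [xget] is determined: for t >= 0 a segment only looks at times t + s >= -
    r_i, where solutions are unique. *)
Lemma skew_productE (w : coef_fun R m) phi y
    (cy : forall i, continuous (y i)) t :
  admissible K w -> 0 <= t -> is_solution w phi y ->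
  skew_product t (w, phi) = (flow t w, segment cy t).
Proof.
move=> wK t0 sy; congr pair; apply: xget_unique.
  by exists y => // i s; rewrite segmentE.
move=> psi [z sz zpsi]; apply: is_segment_uniq => i s.
rewrite zpsi; apply: (is_solution_uniq wK sz sy).
by have := set_valP s; rewrite /= in_itv/= => /andP[s1 _]; rewrite ler_wpDl.
Qed.

End segments.

(** * Almost periodic functions *)

Section ultralimit.
Context {R : realType} {I : Type} (U : set_system I) {UU : UltraFilter U}.

Let PU : ProperFilter U. Proof. exact: ultra_proper. Qed.

(** Compactness of [a, b] gives a cluster point, and an ultrafilter converges to each of its cluster
    points. *)
Lemma ultralimit_exists (f : I -> R) a b : (\forall i \near U, a <= f i <= b) ->
  exists l : R, f @ U --> l.
Proof.
move=> fab.
have [|l [_ cl]] := @segment_compact R a b (f @ U) _.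
  by apply: filterS fab => i; rewrite /= in_itv.
exists l => B nB; have [//|UC] := in_ultra_setVsetC (f @^-1` B) UU.
by have [x [xNB /xNB]] := cl (~` B) B UC nB.
Qed.

End ultralimit.

Section almost_periodic.
Context {R : realType}.
Implicit Types (h : R -> R).

(** Heine's theorem with only one of the two points confined to [a, b]: a translation that brings
    one point of a pair into the interval may leave the other outside. *)
Lemma uniformly_continuous_itvcc h (a b e : R) : continuous h -> 0 < e ->
  exists2 dl, 0 < dl & forall s t, a <= t <= b -> `|s - t| < dl ->
    `|h s - h t| <= e.
Proof.
move=> ch e0.
have e2 : 0 < e / 2 by rewrite divr_gt0.
have /compact_near_coveringP cov := @segment_compact R a b.
pose P (dl t : R) := forall s, `|s - t| < dl -> `|h s - h t| <= e.
have [dl [dl0 hdl]] : exists dl, 0 < dl /\ `[a, b] `<=` P dl.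
  have : \forall dl \near 0^'+, `[a, b] `<=` P dl.
    apply: cov => x _.
    have := ch x; move/cvgrPdist_le => /(_ _ e2) /nbhs_ballP [d /= d0 hd].
    have d2 : 0 < d / 2 by rewrite divr_gt0.
    exists (ball x (d / 2), [set dl | dl < d / 2]) => /=.
      split; first exact: nbhsx_ballx.
      exact: nbhs_right_lt.
    move=> [t dl] /= [xt dld] s st.
    have ht : `|h x - h t| <= e / 2.
      apply: hd; apply: le_ball xt.
      by rewrite ler_pdivrMr// ler_peMr ?(ltW d0)// ler1n.
    have hs : `|h x - h s| <= e / 2.
      apply: hd; rewrite -ball_normE/=; move: xt; rewrite -ball_normE/= => xt.
      have := ler_distD t x s; rewrite (distrC t s); lra.
    have := ler_distD (h x) (h s) (h t); rewrite (distrC (h s) (h x)); lra.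
  move=> /(filterI (nbhs_right_gt _)) /filter_ex[dl [dl0 hdl]].
  by exists dl.
by exists dl => // s t tab; apply: hdl; rewrite /= in_itv.
Qed.

Lemma almost_periodic_uniformly_continuous h e : almost_periodic h -> 0 < e ->
  exists2 dl, 0 < dl & forall s t, `|s - t| < dl -> `|h s - h t| <= e.
Proof.
move=> [ch ap] e0; have e3 : 0 < e / 3 by rewrite divr_gt0.
have [L L0 hL] := ap _ e3.
have [dl dl0 hdl] := uniformly_continuous_itvcc 0 L ch e3.
exists dl => // s t st; have [p hp pL] := hL (- t).
have h1 := hp s; have h2 := hp t.
have : `|h (s + p) - h (t + p)| <= e / 3.
  apply: hdl; first by lra.
  by rewrite opprD addrACA subrr addr0.
have -> : h s - h t = - (h (s + p) - h s) + (h (s + p) - h (t + p)) +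
  (h (t + p) - h t) by ring.
have := ler_normD (- (h (s + p) - h s) + (h (s + p) - h (t + p)))
  (h (t + p) - h t).
have := ler_normD (- (h (s + p) - h s)) (h (s + p) - h (t + p)).
rewrite normrN; lra.
Qed.

Lemma almost_periodic_bounded h : almost_periodic h ->
  exists B, forall t, `|h t| <= B.
Proof.
move=> [ch ap]; have [L L0 hL] := ap _ ltr01.
have [B hB] := within_itvcc_bounded (a := 0) (b := L) (continuous_subspaceT ch).
exists (B + 1) => t; have [p hp pL] := hL (- t).
have : `|h (t + p)| <= B by apply: hB; rewrite in_itv/=; lra.
have := ler_distD (h (t + p)) (h t) 0; rewrite !subr0 distrC.
have := hp t; lra.
Qed.

(* Bochner's criterion: along an ultrafilter the translates of an almost
   periodic function converge uniformly, which makes finitely many almost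
   periodic functions share their almost periods. *)
Lemma almost_periodic_translates_ultra h (U : set_system nat) (s : nat -> R) e :
  UltraFilter U -> almost_periodic h -> 0 < e ->
  exists u, \forall n \near U, forall t, `|h (t + s n) - h (t + u)| <= e.
Proof.
move=> UU ap e0; have PU : ProperFilter U by exact: ultra_proper.
have e2 : 0 < e / 2 by rewrite divr_gt0.
have [dl dl0 hdl] := almost_periodic_uniformly_continuous ap e2.
have [L L0 hL] := ap.2 _ e2.
have /choice[p hp] : forall n, exists p,
    (forall t, `|h (t + p) - h t| < e / 2) /\ s n - L <= p <= s n.
  by move=> n; have [p hp pL] := hL (s n - L); exists p; split => //; lra.
have [u] : exists u : R, (fun n => s n - p n) @ U --> u.
  apply: (@ultralimit_exists _ _ _ _ _ 0 L); apply: nearW => n.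
  by have [_ ?] := hp n; lra.
move/cvgrPdist_lt => /(_ _ dl0) hu; exists u; apply: filterS hu => n un t.
have [hn _] := hp n.
have h1 := hn (t + (s n - p n)).
have h2 : `|h (t + (s n - p n)) - h (t + u)| <= e / 2.
  by apply: hdl; rewrite opprD addrACA subrr add0r distrC.
have := ler_distD (h (t + (s n - p n))) (h (t + s n)) (h (t + u)).
move: h1; have -> : t + (s n - p n) + p n = t + s n by ring.
lra.
Qed.

(** Every translation is uniformly e-close, for all j together, to one by some s0 with |s0| <= N.
    Otherwise there are s_n at which this fails with N = n; by Bochner's criterion s_k and s_n are
    e-close for some k and some n >= |s_k|, although s_k was excluded for s_n. For the translation
    by a + N, the difference a + N - s0 is then a common almost period in [a, a + 2 N]. *)
Lemma joint_almost_periods (J : finType) (f : J -> R -> R) e : 0 < e ->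
  (forall j, almost_periodic (f j)) ->
  relatively_dense [set s | forall j t, `|f j (t + s) - f j t| <= e].
Proof.
move=> e0 ap.
have [N hN] : exists N : nat, forall s, exists2 s0, `|s0| <= N%:R &
    forall j t, `|f j (t + s) - f j (t + s0)| <= e.
  apply: contrapT => /forallNP H.
  have /choice[s hs] : forall n : nat, exists s, forall s0, `|s0| <= n%:R ->
      ~ forall j t, `|f j (t + s) - f j (t + s0)| <= e.
    by move=> n; have /existsNP[s /forall2NP hs] := H n; exists s => s0 s0n hf;
      have [] := hs s0.
  have [U [UU oU]] := ultraFilterLemma (F := \oo) _.
  have PU : ProperFilter U by exact: ultra_proper.
  have e2 : 0 < e / 2 by rewrite divr_gt0.
  have /choice[u hu] j := almost_periodic_translates_ultra s UU (ap j) e2.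
  have {}hu : \forall n \near U, forall j t,
      `|f j (t + s n) - f j (t + u j)| <= e / 2.
    by apply: filter_forall => j; exact: hu.
  have [k hk] := filter_ex hu.
  have [M kM] : exists M : nat, `|s k| <= M%:R.
    by exists (Num.bound `|s k|); rewrite ltW// archi_boundP.
  have UM : U [set n | (M <= n)%N] by apply: oU; exists M.
  have [n [/= Mn hn]] := filter_ex (filterI UM hu).
  apply: (hs n (s k)); first by rewrite (le_trans kM)// ler_nat.
  move=> j t; have := ler_distD (f j (t + u j)) (f j (t + s n)) (f j (t + s k)).
  have := hn j t; have := hk j t; rewrite (distrC (f j (t + s k))); lra.
exists (2 * N%:R + 1) => [|a]; first by rewrite ltr_wpDl// mulr_ge0.
have [s0 s0N hs0] := hN (a + N%:R).
exists (a + N%:R - s0); last by move: s0N; rewrite ler_norml; lra.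
move=> j t /=; have := hs0 j (t - s0); rewrite subrK.
by have -> : t - s0 + (a + N%:R) = t + (a + N%:R - s0) by ring.
Qed.

End almost_periodic.

(** * The hull *)

Section hull.
Context {R : realType} {m : nat}.
Implicit Types (w g : coef_fun R m).

Lemma coef_dist_small (e : R) : 0 < e -> exists2 T : R, 0 <= T & forall w g,
  (forall t, - T <= t <= T -> `|w t - g t| <= e) -> mdist w g <= e.
Proof.
move=> e0; have [N hN] := halfpow_eventually_le 1 e0.
exists N%:R => // w g wg.
rewrite /mdist/=; apply: sup_dist_le => [|n]; first exact: ltW.
rewrite ge_min; have [Nn|nN] := leqP N n.
  apply/orP; left; apply: le_trans hN; rewrite mul1r.
  by rewrite ler_wiXn2l// ?invr_ge0// invf_le1// ler1n.
apply/orP; right; apply: unif_dist_le => [|t tn]; first exact: ltW.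
apply: wg; move: tn; rewrite -!ler_norml => /le_trans; apply.
by rewrite ler_nat ltnW.
Qed.

Lemma coef_dist_close (T e : R) : 0 < e -> exists2 dl : R, 0 < dl & forall w g,
  mdist w g < dl -> forall t, - T <= t <= T -> `|w t - g t| <= e.
Proof.
move=> e0; have [n hn] : exists n : nat, T <= n%:R.
  exists (Num.bound `|T|); rewrite (le_trans (ler_norm _))// ltW//.
  by rewrite archi_boundP.
have p0 : 0 < 2^-1 ^+ n :> R by rewrite exprn_gt0// invr_gt0.
exists (Num.min (2^-1 ^+ n) e) => [|w g wg t tT]; first by rewrite lt_min p0.
have : Num.min (2^-1 ^+ n) (unif_dist n w g) < Num.min (2^-1 ^+ n) e.
  apply: le_lt_trans wg; apply: ub_le_sup; last by exists n.
  exists 1 => _ [k _ <-]; rewrite ge_min exprn_ile1 ?invr_ge0//.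
  by rewrite invf_le1// ler1n.
rewrite gt_min !lt_min ltxx/= => /andP[_ we].
apply: le_trans (ltW we); apply: unif_dist_ub.
by move: tT; rewrite -!ler_norml => /le_trans; apply.
Qed.

Variable l : R -> coef_space R m.
Hypothesis l_ap : forall j, almost_periodic (fun t => coef_proj j (l t)).

(** The closure turned into uniform approximation by translates on compact intervals; bounds and
    moduli are transferred from l to the hull through it. *)
Lemma hull_approx w : hull l w <-> forall T e : R, 0 < e ->
  exists s, forall t, - T <= t <= T -> forall j,
    `|coef_proj j (w t) - coef_proj j (l (t + s))| <= e.
Proof.
split=> [lw T e e0|lw].
  have [dl dl0 hdl] := coef_dist_close T e0.
  have [g [[s gs] wg]] := lw _ (nbhsx_ballx w dl dl0).
  exists s => t tT j; rewrite -gs; apply: le_trans (coef_projB_le _ _ _) _.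
  by apply: hdl tT; move: wg; rewrite ballEmdist.
move=> B /nbhs_ballP[e /= e0 eB].
have e2 : 0 < e / 2 by rewrite divr_gt0.
have [T T0 hT] := coef_dist_small e2; have [s hs] := lw T _ e2.
have ls : continuous (fun t => l (t + s)).
  move=> t; apply/cvg_coefP => j.
  apply: (@continuous_comp _ _ _ (fun t => t + s) (fun t => coef_proj j (l t))).
    by apply: cvgD; [exact: cvg_id|exact: cvg_cst].
  exact: (l_ap j).1.
exists (mkcts ls); split; first by exists s.
apply: eB; rewrite ballEmdist.
apply: (@le_lt_trans _ _ (e / 2)); last first.
  by rewrite ltr_pdivrMr// ltr_pMr// ltr1n.
apply: hT => t tT; apply/coef_norm_leP => [|j]; first exact: ltW.
by rewrite coef_projB; exact: hs.
Qed.

Lemma hull_flow w t : hull l w -> hull l (flow t w).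
Proof.
move=> /hull_approx lw; apply/hull_approx => T e e0.
have [s hs] := lw (T + `|t|) e e0.
exists (t + s) => u uT; rewrite flowE (addrC u) -addrA (addrC s u) addrA.
apply: hs; have := ler_norm t; have := ler_norm (- t); rewrite normrN; lra.
Qed.

Lemma hull_proj_ge b j : (forall t, b <= coef_proj j (l t)) ->
  forall w t, hull l w -> b <= coef_proj j (w t).
Proof.
move=> lb w t /hull_approx lw; apply/ler_addgt0Pl => e e0.
have [s hs] := lw `|t| e e0.
have tt : - `|t| <= t <= `|t| by rewrite -ler_norml.
have := hs t tt j; have := lb (t + s).
rewrite ler_norml; lra.
Qed.

Lemma hull_proj_le b j : (forall t, coef_proj j (l t) <= b) ->
  forall w t, hull l w -> coef_proj j (w t) <= b.
Proof.
move=> lb w t /hull_approx lw; apply/ler_addgt0Pl => e e0.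
have [s hs] := lw `|t| e e0.
have tt : - `|t| <= t <= `|t| by rewrite -ler_norml.
have := hs t tt j; have := lb (t + s).
rewrite ler_norml; lra.
Qed.

Lemma hull_admissible : (forall j t, 0 <= coef_proj j (l t)) ->
  exists2 K : R, 0 < K & forall w, hull l w -> admissible K w.
Proof.
move=> l0; have /choice[B hB] j := almost_periodic_bounded (l_ap j).
exists (1 + \sum_j `|B j|) => [|w lw j t]; first by rewrite ltr_wpDr// sumr_ge0.
rewrite (hull_proj_ge (l0 j))//= (@le_trans _ _ `|B j|)//.
  apply: hull_proj_le lw => s; apply: le_trans (ler_norm _) _.
  exact: le_trans (hB j s) (ler_norm _).
by rewrite (bigD1 j)//= addrCA lerDl addr_ge0// sumr_ge0.
Qed.

Lemma hull_equicontinuous (e : R) : 0 < e -> exists2 dl : R, 0 < dl &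
  forall w, hull l w -> forall j s t, `|s - t| < dl ->
    `|coef_proj j (w s) - coef_proj j (w t)| <= e.
Proof.
move=> e0; have e3 : 0 < e / 3 by rewrite divr_gt0.
have : \forall dl \near 0^'+, forall j s t, `|s - t| < dl ->
    `|coef_proj j (l s) - coef_proj j (l t)| <= e / 3.
  apply: filter_forall => j.
  have [dl dl0 hdl] := almost_periodic_uniformly_continuous (l_ap j) e3.
  near=> d => s t st; apply: hdl; apply: lt_le_trans st _.
  by near: d; exact: nbhs_right_le.
move=> /(filterI (nbhs_right_gt _)) /filter_ex[dl [dl0 hdl]].
exists dl => // w /hull_approx lw j s t st.
have [u hu] := lw (`|s| + `|t|) _ e3.
have sst : - (`|s| + `|t|) <= s <= `|s| + `|t|.
  by rewrite -ler_norml lerDl.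
have tst : - (`|s| + `|t|) <= t <= `|s| + `|t|.
  by rewrite -ler_norml lerDr.
have hs := hu s sst j; have ht := hu t tst j.
have hl : `|coef_proj j (l (s + u)) - coef_proj j (l (t + u))| <= e / 3.
  by apply: hdl; rewrite opprD addrACA subrr addr0.
by move: hs ht hl; rewrite !ler_norml; lra.
Unshelve. all: by end_near. Qed.

(** A column sum of a: the rate at which mass in component i is lost to the system as a whole. *)
Definition dissipation (x : coef_space R m) i : R :=
  coef_proj (inl (inl (inl i))) x - \sum_k coef_proj (inl (inl (inr (k, i)))) x.

Lemma dissipationB_le x y i (e : R) :
  (forall j, `|coef_proj j x - coef_proj j y| <= e) ->
  `|dissipation x i - dissipation y i| <= m.+1%:R * e.
Proof.
move=> h; rewrite /dissipation; set S := \sum_k _; set S' := \sum_k _.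
rewrite (_ : _ - _ = (coef_proj (inl (inl (inl i))) x -
  coef_proj (inl (inl (inl i))) y) - (S - S')); last by ring.
rewrite -sumrB.
apply: le_trans (ler_normB _ _) _; rewrite -natr1 mulrDl mul1r addrC lerD//.
apply: le_trans (ler_norm_sum _ _ _) _.
apply: (@le_trans _ _ (\sum_(k < m) e)); first exact: ler_sum.
by rewrite sumr_const card_ord mulr_natl.
Qed.

Hypothesis l_diss : forall (i : 'I_m) (t : R), 0 < dissipation (l t) i.

(** The strict inequality of a6 does not survive the closure. *)
Lemma hull_dissipation_ge0 w t i : hull l w -> 0 <= dissipation (w t) i.
Proof.
move=> /hull_approx lw; apply/ler_addgt0Pl => e e0.
have e1 : 0 < e / m.+1%:R by rewrite divr_gt0// ltr0Sn.
have [s hs] := lw `|t| _ e1.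
have tt : - `|t| <= t <= `|t| by rewrite -ler_norml.
have := dissipationB_le i (hs t tt); have := l_diss i (t + s).
rewrite (mulrC _ (e / _)) divfK ?pnatr_eq0// ler_norml; lra.
Qed.

(* a6 is not uniform in t, but joint almost periodicity makes the interval
   around 0 where all dissipation rates are bounded below recur in every window. *)
Lemma hull_dissipation_recurrent : exists P len eta : R,
  [/\ 0 < P, 0 < len, 0 < eta &
    forall w, hull l w -> forall t : R, exists2 u : R,
    t <= u /\ u + len <= t + P &
    forall v i, u <= v <= u + len -> eta <= dissipation (w v) i].
Proof.
have l_cont : continuous l.
  by move=> t; apply/cvg_coefP => j; exact: (l_ap j).1.
have [eta [eta0 heta]] : exists eta : R, 0 < eta /\
    forall i, eta <= dissipation (l 0) i.
  have : \forall eta \near 0^'+, forall i, eta <= dissipation (l 0) i.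
    by apply: filter_forall => i; exact: nbhs_right_le.
  by move=> /(filterI (nbhs_right_gt _)) /filter_ex[x [? ?]]; exists x.
(* Three approximations follow: w by a translate of l, a shift by an almost period p, and l near 0.
   Each costs eta / 4 in the rates, which leaves eta / 4. *)
pose e := eta / (4 * m.+1%:R).
have me : m.+1%:R * e = eta / 4.
  by rewrite /e; field; rewrite ?nat1r ?natr1 pnatr_eq0.
have e0 : 0 < e by rewrite divr_gt0// mulr_gt0// ltr0Sn.
have [len len0 hlen] : exists2 len, 0 < len & forall v, 0 <= v <= len ->
    forall j, `|coef_proj j (l v) - coef_proj j (l 0)| <= e.
  have := l_cont 0; move/cvgrPdist_le => /(_ _ e0)/nbhs_ballP[d /= d0 hd].
  exists (d / 2) => [|v vd j]; first by rewrite divr_gt0.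
  rewrite distrC; apply: le_trans (coef_projB_le _ _ _) _.
  by apply: hd; rewrite -ball_normE/= sub0r normrN ger0_norm; lra.
have [L L0 hL] := joint_almost_periods e0 l_ap.
exists (L + len), len, (eta / 4); split => //; [lra|lra|].
move=> w /hull_approx lw t.
have [s hs] := lw (`|t| + (L + len)) e e0.
have [p hp tp] := hL (t + s).
exists (p - s) => [|v i uv]; first by lra.
have hv j : `|coef_proj j (w v) - coef_proj j (l (v + s))| <= e.
  by apply: hs; have := ler_norm t; have := ler_norm (- t); rewrite normrN; lra.
have hv' j : `|coef_proj j (l (v + s)) - coef_proj j (l (v + s - p))| <= e.
  by have := hp j (v + s - p); rewrite subrK.
have hv0 j : `|coef_proj j (l (v + s - p)) - coef_proj j (l 0)| <= e.
  by apply: hlen; lra.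
have := heta i; have := dissipationB_le i hv; have := dissipationB_le i hv'.
have := dissipationB_le i hv0; rewrite me !ler_norml; lra.
Qed.

End hull.

(** * Dissipativity *)

Section window_decay.
Context {R : realType}.
Implicit Types s t u v : R.
Variables (V V' : R -> R) (C P len eta : R).
Hypotheses (C0 : 0 <= C) (P0 : 0 < P) (len0 : 0 < len) (eta0 : 0 < eta).
Hypotheses (V_cont : continuous V)
  (dV : forall t : R, 0 < t -> is_derive t 1 V (V' t))
  (V'_le : forall t, 0 < t -> V' t <= C)
  (V_window : forall t : R, 0 <= t -> exists2 u : R,
     t <= u /\ u + len <= t + P &
     forall v, 0 < v -> u <= v <= u + len -> V' v <= - eta * V v + C).

Let growth s t : 0 <= s -> s <= t -> V t <= V s + C * (t - s).
Proof.
move=> s0 st.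
have dl := is_derive_mulrl C.
have := @increment_le _ V V' (fun x => C * x) (fun=> C) s t st.
rewrite -mulrBr => H; rewrite addrC -lerBlDr; apply: H.
- exact: continuous_subspaceT.
- by apply: continuous_subspaceT => v; exact: is_derive_continuous (dl v).
- by move=> v /andP[sv _]; apply: dV; exact: le_lt_trans s0 sv.
- by move=> v /andP[sv _]; apply: V'_le; exact: le_lt_trans s0 sv.
Qed.

Let q := expR (- eta * len).
Let C' := 2 * C * P + C / eta.

(** On the good subinterval V decays by the factor q up to C / eta; before and after it V gains at
    most C P each, whence C' = 2 C P + C / eta. *)
Lemma window_contraction t : 0 <= t -> V (t + P) <= q * V t + C'.
Proof.
move=> t0; have [u [tu uP] hu] := V_window t0; have l0 := len0.
have u0 : 0 <= u by exact: le_trans t0 tu.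
have q1 : q <= 1 by rewrite -expR0 ler_expR mulNr oppr_le0 mulr_ge0// ltW.
have q0 : 0 <= q by exact: expR_ge0.
have h1 : V u <= V t + C * P.
  apply: le_trans (growth t0 tu) _; rewrite lerD2l ler_wpM2l//; lra.
have h3 : V (t + P) <= V (u + len) + C * P.
  apply: le_trans (growth _ uP) _; first lra.
  rewrite lerD2l ler_wpM2l//; lra.
have h2 : V (u + len) <= q * V u + C / eta.
  (* Integrating factor: V' <= - eta V + C makes h nondecreasing. *)
  pose h v := (C / eta - V v) * expR (eta * v).
  have dh (v : R) : 0 < v ->
      is_derive v 1 h ((C - eta * V v - V' v) * expR (eta * v)).
    move=> v0; have ? := dV v0.
    have d1 : is_derive v 1 (fun v => C / eta - V v) (0 - V' v).
      exact: (@is_deriveB _ _ _ (cst (C / eta)) V).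
    have d2 := is_deriveM d1 (is_derive_expRM eta v).
    apply: is_derive_eq d2 _; rewrite /GRing.scale/=; field; exact: lt0r_neq0.
  have ch : continuous h.
    move=> v; apply: cvgM; last exact: continuous_expRM.
    by apply: cvgB; [exact: cvg_cst|exact: V_cont].
  have ul : u <= u + len by rewrite lerDl ltW.
  have := derivative_ge0_le (f := h)
    (f' := fun v => (C - eta * V v - V' v) * expR (eta * v)) ul.
  move=> /(_ (continuous_subspaceT ch)) H.
  have {H} : h u <= h (u + len).
    apply: H => v /andP[uv vl]; have v0 : 0 < v by exact: le_lt_trans u0 uv.
      exact: dh.
    rewrite mulr_ge0 ?expR_ge0//.
    have uvl : u <= v <= u + len by rewrite !ltW.
    have := hu v v0 uvl; lra.
  rewrite /h mulrDr expRD mulrA (mulrAC _ (expR (eta * u))).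
  rewrite ler_pM2r ?expR_gt0// -ler_pdivrMr ?expR_gt0//.
  rewrite -expRN -mulNr -/q mulrBl => H.
  have : 0 <= C / eta * q by rewrite mulr_ge0// divr_ge0// ltW.
  lra.
have : q * V u <= q * V t + C * P.
  apply: (@le_trans _ _ (q * (V t + C * P))); first by rewrite ler_wpM2l.
  by rewrite mulrDr lerD2l ler_piMl// mulr_ge0// ltW.
rewrite /C'; lra.
Qed.

Let q_lt1 : 0 <= q < 1.
Proof. by rewrite expR_ge0/= -expR0 ltr_expR mulNr oppr_lt0 mulr_gt0. Qed.

(** The fixed point of x |-> q x + C'. *)
Let D := C' / (1 - q).

Let D0 : 0 <= D.
Proof.
have /andP[_ /ltW q1] := q_lt1; have P0' := ltW P0; have eta0' := ltW eta0.
by rewrite /D /C' divr_ge0 ?subr_ge0// addr_ge0 ?divr_ge0 ?mulr_ge0.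
Qed.

Lemma window_iterate n t : 0 <= t -> V (t + n%:R * P) <= q ^+ n * V t + D.
Proof.
move=> t0; have /andP[q0 q1] := q_lt1.
elim: n => [|n IH]; first by rewrite mul0r addr0 expr0 mul1r lerDl.
rewrite -natr1 mulrDl mul1r addrA.
have tn : 0 <= t + n%:R * P by rewrite addr_ge0// mulr_ge0// ltW.
apply: le_trans (window_contraction tn) _.
apply: (@le_trans _ _ (q * (q ^+ n * V t + D) + C')).
  by rewrite lerD2r ler_wpM2l.
rewrite mulrDr mulrA -exprS -addrA lerD2l /D.
by rewrite le_eqVlt; apply/orP; left; apply/eqP; field; lra.
Qed.

(** Write t = s + n P with 0 <= s < P. Then n >= N, and V s <= B + C P as V grows at speed at most
    C. The waiting time depends on V only through B. *)
Lemma window_decay B N : (forall n, (N <= n)%N -> (B + C * P) * q ^+ n <= 1) ->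
  V 0 <= B -> forall t, N.+1%:R * P <= t -> V t <= 1 + D.
Proof.
move=> hN VB t Nt; have /andP[q0 q1] := q_lt1.
have t0 : 0 <= t by apply: le_trans Nt; rewrite mulr_ge0// ltW.
have tP0 : 0 <= t / P by rewrite divr_ge0// ltW.
have /andP[n1 n2] := truncn_itv tP0; set n := Num.truncn _ in n1 n2.
rewrite ler_pdivlMr// in n1; rewrite ltr_pdivrMr// in n2.
have Nn : (N <= n)%N.
  have : N.+1%:R * P < n.+1%:R * P by exact: le_lt_trans Nt n2.
  by rewrite ltr_pM2r// ltr_nat ltnS => /ltnW.
have s0 : 0 <= t - n%:R * P by rewrite subr_ge0.
have := window_iterate n s0; rewrite subrK => /le_trans; apply.
rewrite lerD2r; apply: le_trans _ (hN n Nn).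
rewrite mulrC ler_wpM2r ?exprn_ge0//.
apply: le_trans (growth (lexx 0) s0) _; rewrite subr0 lerD// ler_wpM2l//.
move: n2; rewrite -natr1 mulrDl; lra.
Qed.

End window_decay.

(** * A bound for all solutions, uniform over the hull *)

Section ultimate_bound.
Context {R : realType} {m : nat} (r : 'I_m -> R).
Implicit Types s t u v : R.

(** Exchanging the double sum turns the rows of a into columns; each of the m production terms is at
    most K / c0. *)
Lemma mass_rhs_le (K c0 : R) (w : coef_fun R m) (y : 'I_m -> R -> R) t :
  admissible K w -> 0 < c0 -> (forall i, c0 <= coef_proj (inr i) (w t)) ->
  (forall i t, 0 <= y i t) ->
  \sum_i nicholson_rhs r w y i t <=
    - (\sum_i dissipation (w t) i * y i t) + m%:R * (K / c0).
Proof.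
move=> wK c00 cw y0; under eq_bigr do rewrite nicholson_rhsE.
rewrite !big_split/= exchange_big/= -big_split/= -sumrN; apply: lerD.
  apply: ler_sum => i _; rewrite /dissipation -mulr_suml /=; lra.
apply: (@le_trans _ _ (\sum_(i < m) (K / c0))); last first.
  by rewrite sumr_const card_ord mulr_natl.
apply: ler_sum => i _; rewrite -mulrA.
have /andP[b0 bK] := wK (inl (inr i)) t.
have /andP[g0 gc] := ricker_bounds c00 (cw i) (y0 i (t - r i)).
exact: ler_pM.
Qed.

Variable l : R -> coef_space R m.
Hypotheses (l_ap : forall j, almost_periodic (fun t => coef_proj j (l t)))
  (l_ge0 : forall j t, 0 <= coef_proj j (l t))
  (l_diss : forall (i : 'I_m) t, 0 < dissipation (l t) i).
Variable c0 : R.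
Hypotheses (c0_gt0 : 0 < c0)
  (l_c : forall (i : 'I_m) t, c0 <= coef_proj (inr i) (l t)).

(** The order of quantifiers matters: M precedes B, so a single set can attract every bounded set,
    and T serves all of the hull at once. *)
Lemma ultimate_bound : exists M : R, forall B : R, exists T : R,
  forall w (y : 'I_m -> R -> R),
  hull l w -> (forall i, continuous (y i)) -> (forall i t, 0 <= y i t) ->
  (forall i, y i 0 <= B) ->
  (forall i (t : R), 0 < t -> is_derive t 1 (y i) (nicholson_rhs r w y i t)) ->
  forall i t, T <= t -> y i t <= M.
Proof.
have [K K0 wK] := hull_admissible l_ap l_ge0.
have [P [len [eta [P0 len0 eta0 rec]]]] :=
  hull_dissipation_recurrent l_ap l_diss.
pose C : R := m%:R * (K / c0).
have C0 : 0 <= C by rewrite mulr_ge0// divr_ge0// ltW.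
pose q := expR (- eta * len).
have q1 : 0 <= q < 1.
  by rewrite expR_ge0/= -expR0 ltr_expR mulNr oppr_lt0 mulr_gt0.
exists (1 + (2 * C * P + C / eta) / (1 - q)) => B.
have [N hN] := geometric_eventually_le (m%:R * B + C * P) q1 ltr01.
exists (N.+1%:R * P) => w y lw cy y0 yB dy i t Tt.
pose V t := \sum_i y i t.
apply: (@le_trans _ _ (V t)); first by rewrite /V (bigD1 i)//= lerDl sumr_ge0.
have V'le s : \sum_i nicholson_rhs r w y i s <=
    - (\sum_i dissipation (w s) i * y i s) + C.
  apply: mass_rhs_le (wK _ lw) c0_gt0 _ y0 => k.
  exact: (hull_proj_ge l_ap (l_c k)).
apply: (@window_decay _ V (fun t => \sum_i nicholson_rhs r w y i t) C P len eta
  C0 P0 len0 eta0 _ _ _ _ (m%:R * B) N hN) => //.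
- move=> s; apply: cvg_big => [|k _]; last exact: cy.
  by move=> x; exact: add_continuous.
- move=> s s0; have ? k := dy k s s0.
  rewrite (_ : V = \sum_k y k); first exact: is_derive_sum.
  by apply/funext => x; rewrite fct_sumE.
- move=> s s0; apply: le_trans (V'le s) _.
  rewrite gerDr oppr_le0 sumr_ge0// => k _.
  by rewrite mulr_ge0// (hull_dissipation_ge0 l_ap l_diss).
- move=> s _; have [u us hu] := rec w lw s; exists u => // v v0 uv.
  apply: le_trans (V'le v) _; rewrite lerD2r mulNr lerN2 mulr_sumr.
  by apply: ler_sum => k _; rewrite ler_wpM2r// hu.
- rewrite /V (@le_trans _ _ (\sum_(k < m) B))// ?ler_sum//.
  by rewrite sumr_const card_ord mulr_natl.
Qed.

End ultimate_bound.

(** * Limits along ultrafilters *)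

Section limits.
Context {R : realType}.
Implicit Types s t : R.

Lemma is_derive_translate (f : R -> R) (v a s : R) : is_derive (s + a) 1 f v ->
  is_derive s 1 (fun x => f (x + a)) v.
Proof.
move=> df.
have da : is_derive s 1 (fun x => x + a) 1.
  have := @is_deriveD _ _ _ id (cst a) s 1 1 0 (is_derive_id _ _)
    (is_derive_cst _ _ _).
  by rewrite addr0.
have := @is_derive1_comp _ f (fun x => x + a) s v 1 df da.
by rewrite mulr1.
Qed.

(** A form of differentiability whose increment estimate is preserved by pointwise limits of f. *)
Lemma is_derive_of_increments (f : R -> R) t (v : R) :
  (forall e, 0 < e -> exists2 dl, 0 < dl & forall s, `|s - t| < dl ->
    `|f s - f t - v * (s - t)| <= e * `|s - t|) -> is_derive t 1 f v.
Proof.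
move=> h.
have lim_f : h^-1 *: (f (h *: 1 + t) - f t) @[h --> 0^'] --> v.
  apply/cvgrPdist_le => e e0; have [dl dl0 hdl] := h e e0.
  have := @dnbhs0_lt R R dl dl0; apply: filter_app.
  have := nbhs_dnbhs_neq (0 : R); apply: filterS => x x0 xd.
  have := hdl (x + t); rewrite addrK => /(_ xd).
  have xn : 0 < `|x| by rewrite normr_gt0.
  rewrite /GRing.scale/= mulr1 -ler_pdivrMr// -normf_div => H.
  apply: le_trans _ H; rewrite distrC le_eqVlt; apply/orP; left; apply/eqP.
  by congr `| _ |; field.
by split; [apply/cvg_ex; exists v|exact: cvg_lim].
Qed.

Lemma bounded_derivative_lipschitz (f f' : R -> R) (L a b : R) :
  (forall x, a <= x -> is_derive x 1 f (f' x)) ->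
  (forall x, a <= x <= b -> `|f' x| <= L) ->
  forall s t, a <= s <= b -> a <= t <= b -> `|f s - f t| <= L * `|s - t|.
Proof.
move=> df fL s t; wlog st : s t / t <= s.
  move=> H sab tab; have [ts|/ltW st] := leP t s; first exact: H.
  by rewrite distrC (distrC s); apply: H.
move=> /andP[sa sb] /andP[ta tb]; have st0 : 0 <= s - t by rewrite subr_ge0.
rewrite (ger0_norm st0) mulrBr.
have dl := is_derive_mulrl L.
apply: (@normr_increment_le _ f f' (fun x => L * x) (fun=> L)) => //.
- apply: continuous_in_subspaceT => x; rewrite inE/= in_itv/= => /andP[tx _].
  exact: is_derive_continuous (df x (le_trans ta tx)).
- by apply: continuous_subspaceT => x; exact: is_derive_continuous (dl x).
- by move=> x /andP[tx _]; apply: df; exact: le_trans ta (ltW tx).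
- move=> x /andP[tx xs]; apply: fL.
  by rewrite (le_trans ta (ltW tx)) (le_trans (ltW xs) sb).
Qed.

End limits.

(** * Locally uniform convergence along an ultrafilter *)

Section continuous_convergence.
Context {R : realType} {I : Type} (U : set_system I).
Implicit Types s t : R.

(* f i --> f0 with i --> U and the argument moving as well; since the algebraic
   operations and shifts preserve this mode of convergence, no equicontinuity
   estimate is needed for composite expressions. *)
Definition cc_cvg (f : I -> R -> R) (f0 : R -> R) :=
  forall t, f p.1 p.2 @[p --> filter_prod U (nbhs t)] --> f0 t.

Context {UU : UltraFilter U}.

Let PU : ProperFilter U. Proof. exact: ultra_proper. Qed.

(** Arzela-Ascoli along an ultrafilter: boundedness gives the pointwise limits, equicontinuity lets
    the argument move. *)
Lemma cc_cvg_exists (f : I -> R -> R) :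
  (forall t, exists a b, \forall i \near U, a <= f i t <= b) ->
  (forall t e, 0 < e -> exists2 dl, 0 < dl & \forall i \near U, forall s,
     `|s - t| < dl -> `|f i s - f i t| <= e) ->
  exists f0 : R -> R, cc_cvg f f0.
Proof.
move=> fb fe.
have /choice[f0 hf0] : forall t, exists l : R, f i t @[i --> U] --> l.
  by move=> t; have [a [b hab]] := fb t; exact: ultralimit_exists hab.
exists f0 => t; apply/cvgrPdist_le => e e0.
have e2 : 0 < e / 2 by rewrite divr_gt0.
have [dl dl0 hdl] := fe t _ e2.
have /cvgrPdist_le/(_ _ e2) ht := hf0 t.
exists ([set i | `|f0 t - f i t| <= e / 2 /\
    forall s, `|s - t| < dl -> `|f i s - f i t| <= e / 2], ball t dl).
  by split; [exact: filterI ht hdl|exact: nbhsx_ballx].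
move=> [i s] /= [[h1 h2] ts].
have h3 : `|f i s - f i t| <= e / 2.
  by apply: h2; move: ts; rewrite -ball_normE/= distrC.
have := ler_distD (f i t) (f0 t) (f i s); rewrite (distrC (f i t) (f i s)); lra.
Qed.

Lemma cc_cvg_pointwise (f : I -> R -> R) (f0 : R -> R) t :
  cc_cvg f f0 -> f i t @[i --> U] --> f0 t.
Proof.
move=> cf; apply: (@cvg_comp _ _ _ (fun i => (i, t)) (fun p => f p.1 p.2));
  last exact: cf.
by apply: (@cvg_pair _ _ _ U U (nbhs t) _ _ _ id (cst t));
  [exact: cvg_id|exact: cvg_cst].
Qed.

Lemma cc_cvg_shift (f : I -> R -> R) (f0 : R -> R) (a : R) : cc_cvg f f0 ->
  cc_cvg (fun i s => f i (s - a)) (fun s => f0 (s - a)).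
Proof.
move=> cf t; apply: (@cvg_comp _ _ _ (fun p => (p.1, p.2 - a))
  (fun p => f p.1 p.2)); last exact: cf.
apply: (@cvg_pair _ _ _ _ U (nbhs (t - a)) _ _ _ fst (fun p => p.2 - a)).
  exact: cvg_fst.
by apply: cvgB; [exact: cvg_snd|exact: cvg_cst].
Qed.

Lemma cc_cvg_continuous (f : I -> R -> R) (f0 : R -> R) :
  cc_cvg f f0 -> continuous f0.
Proof.
move=> cf t; apply/cvgrPdist_le => e e0.
have e2 : 0 < e / 2 by rewrite divr_gt0.
have /cvgrPdist_le/(_ _ e2) [[A B] /= [UA tB] hAB] := cf t.
apply: filterS tB => s Bs.
have /cvgrPdist_le/(_ _ e2) hs := cc_cvg_pointwise (t := s) cf.
have [i [Ai his]] := filter_ex (filterI UA hs).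
have h1 : `|f0 t - f i s| <= e / 2 by exact: (hAB (i, s)).
have := ler_distD (f i s) (f0 t) (f0 s); rewrite (distrC (f i s)).
move: his => /=; lra.
Qed.

Lemma cc_cvg_uniform (f : I -> R -> R) (f0 : R -> R) (a b e : R) :
  cc_cvg f f0 -> 0 < e ->
  \forall i \near U, forall t, a <= t <= b -> `|f i t - f0 t| <= e.
Proof.
move=> cf e0; have e2 : 0 < e / 2 by rewrite divr_gt0.
have /compact_near_coveringP cov := @segment_compact R a b.
have : \forall i \near U, `[a, b] `<=` (fun t => `|f i t - f0 t| <= e).
  apply: cov => t _.
  have /cvgrPdist_le/(_ _ e2) [[A B] /= [UA tB] hAB] := cf t.
  have /cvgrPdist_le/(_ _ e2) hs : f0 s @[s --> t] --> f0 t.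
    exact: (cc_cvg_continuous cf).
  exists ([set s | B s /\ `|f0 t - f0 s| <= e / 2], A) => /=.
    by split => //; exact: filterI.
  move=> [s i] /= [[Bs ts] Ai].
  have := hAB (i, s) (conj Ai Bs) => /= h.
  have := ler_distD (f0 t) (f i s) (f0 s); rewrite (distrC (f i s) (f0 t)); lra.
by apply: filterS => i h t tab; apply: h; rewrite /= in_itv.
Qed.

(** Near t the derivative of f_i(x) - v x is at most e in absolute value, so this function is
    e-Lipschitz there; the estimate passes to the pointwise limit. *)
Lemma cc_cvg_is_derive (f g : I -> R -> R) (f0 : R -> R) t (v d : R) : 0 < d ->
  (\forall i \near U, forall s, t - d <= s -> is_derive s 1 (f i) (g i s)) ->
  (forall s, f i s @[i --> U] --> f0 s) ->
  g p.1 p.2 @[p --> filter_prod U (nbhs t)] --> v -> is_derive t 1 f0 v.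
Proof.
move=> d0 df cf cg; apply: is_derive_of_increments => e e0.
have /cvgrPdist_le/(_ _ e0) [[A B] /= [UA /nbhs_ballP[dl /= dl0 dlB]] hAB] := cg.
have m0 : 0 < Num.min (dl / 2) d by rewrite lt_min d0 divr_gt0.
(* Half of [dl] keeps the closed interval inside the open ball, and d keeps it where the f_i are
   known to be differentiable. *)
exists (Num.min (dl / 2) d) => // s st.
set a := Num.min (dl / 2) d in m0 st.
have near_le : \forall i \near U, `|f i s - f i t - v * (s - t)| <= e * `|s - t|.
  apply: filterS (filterI UA df) => i [Ai dfi].
  have dh x : t - a <= x ->
      is_derive x 1 (fun x => f i x - v * x) (g i x - v).
    move=> ax; have ? : is_derive x 1 (f i) (g i x).
      apply: dfi; apply: le_trans ax; rewrite lerD2l lerN2 /a.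
      by rewrite ge_min lexx orbT.
    have dv := is_derive_mulrl v x.
    exact: is_deriveB.
  have -> : f i s - f i t - v * (s - t) =
      (f i s - v * s) - (f i t - v * t) by ring.
  apply: (bounded_derivative_lipschitz (b := t + a) dh) => [x xa||].
  - rewrite distrC; apply: (hAB (i, x)); split => //=; apply: dlB.
    rewrite -ball_normE/= ltr_distlC.
    have : a <= dl / 2 by rewrite /a ge_min lexx.
    lra.
  - by move: st; rewrite ltr_distl; lra.
  - by lra.
have cfst : f i s - f i t - v * (s - t) @[i --> U] --> f0 s - f0 t - v * (s - t).
  by apply: cvgB; [apply: cvgB; exact: cf|exact: cvg_cst].
apply: (@closed_cvg _ _ _ _ (fun i => `|f i s - f i t - v * (s - t)|)
  (fun x => x <= e * `|s - t|) _ near_le).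
  exact: closed_le.
exact: cvg_norm cfst.
Qed.

End continuous_convergence.

(** * Limits of coefficients and of solutions *)

Section solution_limits.
Context {R : realType} {m : nat} (r : 'I_m -> R).
Implicit Types (s t u : R) (w : coef_fun R m) (y : 'I_m -> R -> R).
Hypothesis r_ge0 : forall i, 0 <= r i.

(** Comparison with the zero solution. It bounds y' uniformly and so makes bounded solutions
    equicontinuous. *)
Lemma nicholson_rhs_bound (K M : R) w y i t : admissible K w ->
  (forall k, 0 <= y k t <= M) -> 0 <= y i (t - r i) <= M ->
  `|nicholson_rhs r w y i t| <= K * (m.+2%:R * M).
Proof.
move=> wK yM yrM; have zero_rhs : nicholson_rhs r w (fun _ _ => 0) i t = 0.
  rewrite nicholson_rhsE !mulr0 mul0r addr0 add0r big1// => k _.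
  by rewrite mulr0.
have yM' k : `|y k t - 0| <= M.
  by rewrite subr0; have /andP[? ?] := yM k; rewrite ger0_norm.
have yrM' : `|y i (t - r i) - 0| <= M.
  by rewrite subr0; have /andP[? ?] := yrM; rewrite ger0_norm.
have /andP[yr0 _] := yrM.
have yrN : - 0 <= y i (t - r i) by rewrite oppr0.
have zN : - 0 <= 0 :> R by rewrite oppr0.
have := nicholson_rhs_lipschitz (r := r) (y := y) (z := fun _ _ => 0) (i := i)
  (t := t) wK (lexx 0) yrN zN yM' yrM'.
rewrite zero_rhs subr0 !mulr0 expR0 mul1r => /le_trans; apply.
by rewrite le_eqVlt; apply/orP; left; apply/eqP; rewrite -[in RHS]natr1; ring.
Qed.

Variable l : R -> coef_space R m.
Hypotheses (l_ap : forall j, almost_periodic (fun t => coef_proj j (l t)))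
  (l_ge0 : forall j t, 0 <= coef_proj j (l t)).

Section hull_limits.
Context {I : Type} (U : set_system I) {UU : UltraFilter U}.

Let PU : ProperFilter U. Proof. exact: ultra_proper. Qed.

Lemma hull_ultralimit (w : I -> coef_fun R m) :
  (\forall i \near U, hull l (w i)) -> exists w0, [/\ hull l w0, w @ U --> w0 &
    forall j, cc_cvg U (fun i s => coef_proj j (w i s))
      (fun s => coef_proj j (w0 s))].
Proof.
move=> lw; have [K K0 wK] := hull_admissible l_ap l_ge0.
have /choice[f0 hf0] : forall j, exists f0 : R -> R,
    cc_cvg U (fun i s => coef_proj j (w i s)) f0.
  move=> j; apply: cc_cvg_exists => [t|t e e0].
    by exists 0, K; apply: filterS lw => i /wK; exact.
  have [dl dl0 hdl] := hull_equicontinuous l_ap e0.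
  by exists dl => //; apply: filterS lw => i lwi s st; exact: hdl.
have cw0 : continuous (fun s => coef_of (fun j => f0 j s)).
  move=> s; apply/cvg_coefP => j; under eq_fun do rewrite coef_projK.
  rewrite coef_projK; exact: (cc_cvg_continuous (hf0 j)).
pose w0 : coef_fun R m := mkcts cw0.
have w0E j s : coef_proj j (w0 s) = f0 j s by rewrite -[RHS](coef_projK (f0^~ s)).
have ww0 : w @ U --> w0.
  apply/metricType_numDomainType.cvgrPdist_lt => e e0.
  have e2 : 0 < e / 2 by rewrite divr_gt0.
  have [T T0 hT] := coef_dist_small (m := m) e2.
  have : \forall i \near U, forall j t, - T <= t <= T ->
      `|coef_proj j (w i t) - f0 j t| <= e / 2.
    by apply: filter_forall => j; exact: cc_cvg_uniform.
  apply: filterS => i hi; apply: (@le_lt_trans _ _ (e / 2)).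
    apply: hT => t tT; apply/coef_norm_leP => [|j]; first exact: ltW.
    by rewrite coef_projB w0E distrC; exact: hi.
  by rewrite ltr_pdivrMr// ltr_pMr// ltr1n.
exists w0; split => //.
  exact: (closed_cvg (hull l) (@closed_closure _ _) lw).
by move=> j; rewrite (_ : (fun s => _) = f0 j); [exact: hf0|apply/funext].
Qed.

Variables (M : R) (w : I -> coef_fun R m) (y : I -> 'I_m -> R -> R).
Hypotheses (lw : \forall i \near U, hull l (w i))
  (hy : forall T : R, \forall i \near U, forall k t, - T <= t ->
     0 <= y i k t <= M /\
     is_derive t 1 (y i k) (nicholson_rhs r (w i) (y i) k t)).

(** In [hy] the index may depend on T: each [y i] need solve the equation on a half-line only, and
    the limit is nevertheless entire. *)
Lemma solution_ultralimit : exists w0 y0,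
  [/\ hull l w0, w @ U --> w0, forall k, cc_cvg U (fun i => y i k) (y0 k),
      forall k t, 0 <= y0 k t <= M &
      forall k t, is_derive t 1 (y0 k) (nicholson_rhs r w0 y0 k t)].
Proof.
have [K K0 wK] := hull_admissible l_ap l_ge0.
have [w0 [lw0 ww0 cw0]] := hull_ultralimit lw.
have /choice[y0 hy0] : forall k, exists y0 : R -> R, cc_cvg U (fun i => y i k) y0.
  move=> k; apply: cc_cvg_exists => [t|t e e0].
    exists 0, M; apply: filterS (hy (- t)) => i /(_ k t)[]//.
    by rewrite opprK.
  pose L := K * (m.+2%:R * M); pose L1 := `|L| + 1.
  have L10 : 0 < L1 by rewrite ltr_pwDr.
  pose d := Num.min 1 (e / L1).
  have d1 : d <= 1 by rewrite /d ge_min lexx.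
  have d0 : 0 < d by rewrite lt_min ltr01 divr_gt0.
  have dL : d * L1 <= e by rewrite -ler_pdivlMr// /d ge_min lexx orbT.
  exists d => //.
  (* One delay further back than t - 1, since the derivative at x >= t - 1 involves the value at x -
     r_k. *)
  apply: filterS (filterI lw (hy (- (t - 1 - r k)))) => i [lwi hyi] s st.
  rewrite opprK in hyi.
  have rk := r_ge0 k.
  apply: le_trans dL; rewrite mulrC.
  apply: (@le_trans _ _ (L1 * `|s - t|)); last by rewrite ler_wpM2l// ltW.
  apply: (@bounded_derivative_lipschitz _ (y i k)
    (nicholson_rhs r (w i) (y i) k) L1 (t - 1) (t + 1)).
  - by move=> x xt; apply: (hyi k x _).2; lra.
  - move=> x xt; apply: (@le_trans _ _ L); last first.
      by rewrite (le_trans (ler_norm _))// lerDl.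
    apply: nicholson_rhs_bound (wK _ lwi) _ _ => [k'|].
      by apply: (hyi k' x _).1; lra.
    by apply: (hyi k _ _).1; lra.
  - by move: st; rewrite ltr_distl; lra.
  - by lra.
exists w0, y0; split => // k t.
  have ct : y i k t @[i --> U] --> y0 k t by exact: (cc_cvg_pointwise (hy0 k)).
  have near_itv : \forall i \near U, 0 <= y i k t <= M.
    by apply: filterS (hy (- t)) => i /(_ k t)[]//; rewrite opprK.
  apply/andP; split.
    apply: (@closed_cvg _ _ _ _ (fun i => y i k t) (fun x => 0 <= x) _ _ _ ct).
      exact: closed_ge.
    by apply: filterS near_itv => i /andP[].
  apply: (@closed_cvg _ _ _ _ (fun i => y i k t) (fun x => x <= M) _ _ _ ct).
    exact: closed_le.
  by apply: filterS near_itv => i /andP[].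
apply: (@cc_cvg_is_derive _ _ U _ (fun i => y i k)
  (fun i s => nicholson_rhs r (w i) (y i) k s) (y0 k) t _ 1 ltr01).
- apply: filterS (hy (- (t - 1))) => i hyi s ts.
  by apply: (hyi k s _).2; rewrite opprK.
- by move=> s; exact: (cc_cvg_pointwise (t := s) (hy0 k)).
apply: (@nicholson_rhs_cvg _ _ r _ (filter_prod U (nbhs t)) _
  (fun p => w p.1) (fun p => y p.1) snd).
- by move=> j; exact: (cw0 j t).
- by move=> k2; exact: (hy0 k2 t).
exact: (cc_cvg_shift (a := r k) (hy0 k) (t := t)).
Qed.

End hull_limits.
End solution_limits.

(** * The attractor *)

Section attractor.
Context {R : realType} {m : nat} (r : 'I_m -> R).
Implicit Types (s t u : R) (w : coef_fun R m) (y : 'I_m -> R -> R).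
Hypothesis r_ge0 : forall i, 0 <= r i.

Lemma nicholson_rhs_shift w y t i s :
  nicholson_rhs r (flow t w) (fun k s => y k (s + t)) i s =
  nicholson_rhs r w y i (s + t).
Proof.
rewrite !nicholson_rhsE flowE (addrC t) (_ : s - r i + t = s + t - r i)//.
by rewrite addrAC.
Qed.

Lemma flow_flow s t w : flow s (flow t w) = flow (t + s) w.
Proof. by apply/continuousEP => u; rewrite !flowE addrA. Qed.

Lemma flow0 w : flow 0 w = w.
Proof. by apply/continuousEP => u; rewrite flowE add0r. Qed.

Lemma history_dist_le (phi psi : history r) (e : R) : 0 <= e ->
  (forall i x, `|phi i x - psi i x| <= e) -> mdist phi psi <= e.
Proof. by move=> e0 h; apply: sup_dist_le => // -[i s]; exact: h. Qed.

Variable l : R -> coef_space R m.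
Hypotheses (l_ap : forall j, almost_periodic (fun t => coef_proj j (l t)))
  (l_ge0 : forall j t, 0 <= coef_proj j (l t)).
Variable M : R.

Definition entire_solution w y :=
  (forall k t, 0 <= y k t <= M) /\
  (forall k t, is_derive t 1 (y k) (nicholson_rhs r w y k t)).

Definition bounded_entire_set : set (coef_fun R m * history r) :=
  [set p | hull l p.1 /\ exists2 y, entire_solution p.1 y & is_segment y 0 p.2].

Lemma entire_solution_continuous w y : entire_solution w y ->
  forall k, continuous (y k).
Proof. by move=> [_ dy] k t; exact: is_derive_continuous (dy k t). Qed.

Lemma entire_solution_shift w y t : entire_solution w y ->
  entire_solution (flow t w) (fun k s => y k (s + t)).
Proof.
move=> [y0 dy]; split=> [k s|k s]; first exact: y0.
rewrite nicholson_rhs_shift.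
exact: (is_derive_translate (f := y k) (dy k (s + t))).
Qed.

Lemma entire_solution_is_solution w y (phi : history r) : entire_solution w y ->
  is_segment y 0 phi -> is_solution w phi y.
Proof.
move=> ey sy; have cy := entire_solution_continuous ey.
case: ey => _ dy; split => // [i|i]; first exact: continuous_subspaceT.
have := is_derive_right_slope (dy i 0).
by under eq_fun do rewrite add0r.
Qed.

Lemma bounded_entire_set_sub : bounded_entire_set `<=` hull l `*` nonneg_cone r.
Proof.
move=> [w phi] [/= lw [y [y0 _] sy]]; split => //= i s.
by rewrite sy; have /andP[] := y0 i (0 + set_val s).
Qed.

(** The index type is free: compactness takes the phase space itself with an arbitrary ultrafilter
    on it, attraction takes the natural numbers. *)
Lemma bounded_entire_set_ultralimit I (U : set_system I) (w : I -> coef_fun R m)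
    (phi : I -> history r) (y : I -> 'I_m -> R -> R) :
  UltraFilter U -> (\forall i \near U, hull l (w i)) ->
  (\forall i \near U, is_segment (y i) 0 (phi i)) ->
  (forall T : R, \forall i \near U, forall k t, - T <= t -> 0 <= y i k t <= M /\
     is_derive t 1 (y i k) (nicholson_rhs r (w i) (y i) k t)) ->
  exists2 p, bounded_entire_set p & w @ U --> p.1 /\ phi @ U --> p.2.
Proof.
move=> UU lw sy hy; have PU : ProperFilter U by exact: ultra_proper.
have [w0 [y0 [lw0 ww0 cy0 y0M dy0]]] := solution_ultralimit r_ge0 l_ap l_ge0 lw hy.
have cont_y0 := entire_solution_continuous (conj y0M dy0).
exists (w0, segment cont_y0 0); first by split => //; exists y0.
split => //=; apply/metricType_numDomainType.cvgrPdist_lt => e e0.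
have e2 : 0 < e / 2 by rewrite divr_gt0.
have near_y : \forall i \near U, forall k t, - r k <= t <= 0 ->
    `|y i k t - y0 k t| <= e / 2.
  apply: filter_forall => k; exact: (cc_cvg_uniform _ _ (cy0 k) e2).
apply: filterS (filterI sy near_y) => i [syi hi].
apply: (@le_lt_trans _ _ (e / 2)); last by rewrite ltr_pdivrMr// ltr_pMr// ltr1n.
apply: history_dist_le => [|k s]; first exact: ltW.
rewrite segmentE syi add0r distrC; apply: hi.
by have := set_valP s; rewrite /= in_itv.
Qed.

Lemma bounded_entire_set_compact : compact bounded_entire_set.
Proof.
rewrite compact_ultra => F UF FA; have PF : ProperFilter F by exact: ultra_proper.
have /choice[y hy] : forall p : coef_fun R m * history r,
    exists y, bounded_entire_set p -> entire_solution p.1 y /\ is_segment y 0 p.2.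
  move=> p; have [[_ [y ey sy]]|np] := pselect (bounded_entire_set p).
    by exists y.
  by exists (fun _ _ => 0) => /np.
have [|||[w0 phi0] A0 [cw cphi]] :=
    @bounded_entire_set_ultralimit _ F fst snd y UF.
- by apply: filterS FA => p [].
- by apply: filterS FA => p /hy[].
- move=> T; apply: filterS FA => p /hy[[y0 dy] _] k t _.
  by split; [exact: y0|exact: dy].
exists (w0, phi0); split => //=.
apply: cvg_trans (cvg_pair cw cphi) => P /= FP.
by apply: (@filterS _ F _ _ _ _ FP) => -[].
Qed.

Variables (K : R) (K0 : 0 < K).
Hypothesis wK : forall w, hull l w -> admissible K w.

Lemma skew_product_entire w y t (cy : forall k, continuous (y k))
    (phi : history r) :
  hull l w -> 0 <= t -> entire_solution w y -> is_segment y 0 phi ->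
  skew_product t (w, phi) = (flow t w, segment cy t).
Proof.
move=> lw t0 ey sy; apply: (skew_productE r_ge0 K0 cy (wK lw) t0).
exact: entire_solution_is_solution.
Qed.

Lemma bounded_entire_set_invariant t : 0 <= t ->
  skew_product t @` bounded_entire_set = bounded_entire_set.
Proof.
move=> t0; apply/seteqP; split=> [_ [[w phi] [/= lw [y ey sy]] <-]|].
  have cy := entire_solution_continuous ey.
  rewrite (skew_product_entire cy lw t0 ey sy); split => /=.
    exact: hull_flow.
  exists (fun k s => y k (s + t)); first exact: entire_solution_shift.
  by move=> i s; rewrite segmentE add0r addrC.
(* A preimage of (w, y_0) is its own past: the flow at - t together with the segment y_(- t). *)
move=> [w phi] [/= lw [y ey sy]].
have cy := entire_solution_continuous ey.
have ez := entire_solution_shift (- t) ey.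
have cz := entire_solution_continuous ez.
exists (flow (- t) w, segment cz 0).
  split => /=; first exact: hull_flow.
  by exists (fun k s => y k (s - t)).
have lw' : hull l (flow (- t) w) by exact: hull_flow.
rewrite (skew_product_entire cz lw' t0 ez)//.
rewrite flow_flow addNr flow0; congr pair; apply/esym.
apply: is_segment_uniq => i s; rewrite sy.
by congr (y i _); ring.
Qed.

Hypothesis M_bound : forall B : R, exists T : R, forall w y,
  hull l w -> (forall i, continuous (y i)) -> (forall i t, 0 <= y i t) ->
  (forall i, y i 0 <= B) ->
  (forall i t, 0 < t -> is_derive t 1 (y i) (nicholson_rhs r w y i t)) ->
  forall i t, T <= t -> y i t <= M.

Lemma bounded_entire_set_attracts (X1 : set (history r)) (e : R) :
  X1 `<=` nonneg_cone r -> bounded_histories X1 -> 0 < e ->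
  exists T : R, forall t p, T <= t -> hull l p.1 -> X1 p.2 ->
    exists2 q, bounded_entire_set q & prod_dist (skew_product t p) q <= e.
Proof.
move=> X1_ge0 [B X1B] e0; apply: contrapT => /forallNP H.
have /choice[tp htp] : forall n : nat, exists tp : R * (coef_fun R m * history r),
    [/\ n%:R <= tp.1, hull l tp.2.1, X1 tp.2.2 & forall q, bounded_entire_set q ->
       ~ prod_dist (skew_product tp.1 tp.2) q <= e].
  move=> n; have /existsNP[t /existsNP[p]] := H n%:R.
  move=> /not_implyP[nt /not_implyP[lp]].
  move=> /not_implyP[Xp np]; exists (t, p); split => //= q Aq qe.
  by apply: np; exists q.
have /choice[z hz] : forall n, exists z : 'I_m -> R -> R,
    is_solution (tp n).2.1 (tp n).2.2 z /\
    ((forall i, continuous (z i)) /\ (forall i t, 0 <= z i t)).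
  move=> n; have [_ lp Xp _] := htp n.
  by have [z sz cz] := is_solution_exists r_ge0 K0 (wK lp) (X1_ge0 _ Xp); exists z.
have cz n := (hz n).2.1.
have [T hT] := M_bound B.
have [U [UU oU]] := ultraFilterLemma (F := \oo) _.
have PU : ProperFilter U by exact: ultra_proper.
have skewE n : skew_product (tp n).1 (tp n).2 =
    (flow (tp n).1 (tp n).2.1, segment (cz n) (tp n).1).
  have [nt lp _ _] := htp n; rewrite [in LHS](surjective_pairing (tp n).2).
  apply: (skew_productE r_ge0 K0 (cz n) (wK lp)); last exact: (hz n).1.
  exact: le_trans nt.
have [|||q Aq [cw cphi]] := @bounded_entire_set_ultralimit _ U
    (fun n => flow (tp n).1 (tp n).2.1) (fun n => segment (cz n) (tp n).1)
    (fun n k s => z n k (s + (tp n).1)) UU.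
- by apply: nearW => n; have [_ lp _ _] := htp n; exact: hull_flow.
- by apply: nearW => n i s; rewrite segmentE add0r addrC.
(* For n >= N and t >= - T', the time t + t_n is positive, so the equation holds, and exceeds T, so
   the bound M holds. *)
- move=> T'; have [N hN] : exists N : nat, `|T'| + `|T| + 1 <= N%:R.
    by exists (Num.bound (`|T'| + `|T| + 1)); rewrite ltW// archi_boundP.
  have UN : U [set n | (N <= n)%N] by apply: oU; exists N.
  apply: filterS UN => n /= Nn k t tT'; have [nt lp Xp _] := htp n.
  have Nn' : N%:R <= n%:R :> R by rewrite ler_nat.
  have nT := ler_norm T; have nT' := ler_norm T'.
  have nT0 := normr_ge0 T; have nT0' := normr_ge0 T'.
  have [[sz _ dz _] [_ z0]] := hz n.
  split; last first.
    rewrite nicholson_rhs_shift; apply: (is_derive_translate (f := z n k)).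
    by apply: dz; lra.
  rewrite z0/=; apply: (hT _ (z n) lp (cz n) z0 _ dz); last by lra.
  move=> i; have s0 : (0 : R) \in (`[- r i, 0]%classic : set R).
    by rewrite inE/= in_itv/= lexx oppr_le0 r_ge0.
  have := sz i (exist _ 0 s0); rewrite /= addr0 => <-.
  by apply: le_trans (ler_norm _) _; exact: X1B.
have e1 := metricType_numDomainType.cvgr_dist_le cw e0.
have e2 := metricType_numDomainType.cvgr_dist_le cphi e0.
have [n [/= h1 h2]] := filter_ex (filterI (e1 _) (e2 _)).
have [_ _ _ hn] := htp n; apply: (hn q Aq).
by rewrite skewE /prod_dist ge_max /= metric_sym h1 metric_sym h2.
Qed.

Lemma hausdorff_semidist_cvg0 (X1 : set (history r)) :
  X1 `<=` nonneg_cone r -> bounded_histories X1 ->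
  hausdorff_semidist (skew_product t @` (hull l `*` X1)) bounded_entire_set
    @[t --> +oo] --> 0%E.
Proof.
move=> X1_ge0 X1B P /= [e /= e0 eP].
have e2 : 0 < e / 2 by rewrite divr_gt0.
have [T hT] := bounded_entire_set_attracts X1_ge0 X1B e2.
exists T; split; first exact: num_real.
move=> t Tt /=; set D := hausdorff_semidist _ _.
have D0 : (0 <= D)%E by apply: ereal_sup_ubound; left.
have De : (D <= (e / 2)%:E)%E.
  apply: ge_ereal_sup => _ [->|[_ [p [lp Xp] <-] <-]]; first by rewrite lee_fin ltW.
  have [q Aq pq] := hT t p (ltW Tt) lp Xp.
  apply: le_trans (ereal_inf_lbound _) _; first by exists q.
  by rewrite lee_fin.
(* Neighbourhoods of 0 in the extended reals are tested on real numbers, so D has to be finite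
   before it is compared with e. *)
have Dfin : D \is a fin_num.
  by rewrite ge0_fin_numE// (le_lt_trans De)// ltry.
rewrite -(fineK Dfin); apply: eP => /=.
rewrite sub0r normrN ger0_norm ?fine_ge0//.
rewrite -lte_fin fineK//; apply: le_lt_trans De _.
by rewrite lte_fin ltr_pdivrMr// ltr_pMr// ltr1n.
Qed.

End attractor.

Theorem theorem3p1 (R : realType) (m : nat) (r : 'I_m -> R)
  (d : 'I_m -> R -> R) (a : 'I_m -> 'I_m -> R -> R) (beta c : 'I_m -> R -> R)
  (r_gt0 : forall i, 0 < r i)
  (a1 : (forall i, almost_periodic (d i)) /\
        (forall i j, almost_periodic (a i j)) /\
        (forall i, almost_periodic (c i)) /\
        (forall i, almost_periodic (beta i)))
  (a2 : exists2 d0 : R, 0 < d0 & forall t i, d0 <= d i t)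
  (a3 : (forall i j t, 0 <= a i j t) /\ (forall i t, a i i t = 0))
  (a4 : forall t i, 0 < beta i t)
  (a5 : exists2 c0 : R, 0 < c0 & forall t i, c0 <= c i t)
  (a6 : forall t i, 0 < d i t - \sum_j a j i t) :
  let Omega := hull (coefficient_map d a beta c) in
  exists A : set (coef_fun R m * history r),
    [/\ A `<=` Omega `*` nonneg_cone r,
        compact A,
        forall t : R, 0 <= t -> skew_product t @` A = A &
        forall X1 : set (history r),
          X1 `<=` nonneg_cone r -> bounded_histories X1 ->
          hausdorff_semidist (skew_product t @` (Omega `*` X1)) A
            @[t --> +oo] --> 0%E].
Proof.
move: a1 a2 a3 a5 => [d_ap [a_ap [c_ap beta_ap]]] [d0 d0_gt0 d_ge] [a_ge0 _].
move=> [c0 c0_gt0 c_ge] Omega; pose l := coefficient_map d a beta c.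
have l_ap j : almost_periodic (fun t => coef_proj j (l t)).
  case: j => [[[i|[i k]]|i]|i]; under eq_fun do rewrite /= mxE.
  - exact: d_ap.
  - exact: a_ap.
  - exact: beta_ap.
  - exact: c_ap.
have l_ge0 j t : 0 <= coef_proj j (l t).
  case: j => [[[i|[i k]]|i]|i]; rewrite /= mxE.
  - exact: le_trans (ltW d0_gt0) (d_ge t i).
  - exact: a_ge0.
  - exact: ltW.
  - exact: le_trans (ltW c0_gt0) (c_ge t i).
have l_diss i t : 0 < dissipation (l t) i.
  rewrite /dissipation /= mxE; under eq_bigr do rewrite mxE.
  exact: a6.
have l_c i t : c0 <= coef_proj (inr i) (l t) by rewrite /= mxE.
have r_ge0 i : 0 <= r i by exact: ltW.
have [K K0 wK] := hull_admissible l_ap l_ge0.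
have [M hM] := ultimate_bound r l_ap l_ge0 l_diss c0_gt0 l_c.
exists (@bounded_entire_set R m r l M); split.
- exact: bounded_entire_set_sub.
- exact: bounded_entire_set_compact.
- exact: (bounded_entire_set_invariant r_ge0 l_ap _ K0 wK).
- exact: (hausdorff_semidist_cvg0 r_ge0 l_ap l_ge0 K0 wK hM).
Qed.
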